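(* Let $E$ be a real Banach space, let $p \in [1,\infty)$ and let $N \geq 1$ be an integer. Let $(\overline{\Omega},\overline{\mathcal{F}},\overline{\mathbb{P}})$ be a probability space and let $\overline{\mathbf{X}}$ be a $\mathcal{C}_0^{0,p\text{-var}}(\mathbb{R},T_1^N(E))$-valued random variable defined on it. Assume that $\overline{\mathbf{X}}$ has stationary increments, i.e. the distribution of the process $(\overline{\mathbf{X}}_{t_0,t_0+h})_{h\in\mathbb{R}}$ does not depend on $t_0 \in \mathbb{R}$. Then there exist a measurable metric dynamical system $(\Omega,\mathcal{F},\mathbb{P},\theta)$ and a $\mathcal{C}_0^{0,p\text{-var}}(\mathbb{R},T_1^N(E))$-valued random variable $\mathbf{X}$ defined on $\Omega$ such that $\mathbf{X}$ has the same law as $\overline{\mathbf{X}}$ and $\mathbf{X}$ has the cocycle property $$\mathbf{X}_{s+t}(\omega) = \mathbf{X}_s(\omega)\otimes \mathbf{X}_t(\theta_s\omega) \quad\text{for every } \omega\in\Omega \text{ and all } s,t\in\mathbb{R},$$ that is, $\mathbf{X}_{s,s+t}(\omega)=\mathbf{X}_t(\theta_s\omega)$.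
   Context: $(E,|\cdot|)$ is a real Banach space, not necessarily separable. Algebraic tensor powers of $E$ carry compatible norms: $|v\otimes w|=|w\otimes v|$ and $|v\otimes w|\le |v||w|$, with the analogous assumptions for higher-order tensors; $E^{\otimes k}$ is the completion. $T_1^N(E)=\{(1,g^1,\dots,g^N): g^k\in E^{\otimes k}\}$ is a topological group for $\pi_k(g\otimes h)=\sum_{i=0}^k g^{k-i}\otimes h^i$, with unit $\mathbf{1}=(1,0,\dots,0)$; $\pi_k$ is the projection to the $k$-th level, and $|g|=\max_k|\pi_k(g)|$. For a path $\mathbf{x}$ in $T_1^N(E)$, $\mathbf{x}_{s,t}:=\mathbf{x}_s^{-1}\otimes\mathbf{x}_t$. Let $I\subset\mathbb{R}$ be a compact interval containing $0$. $\mathcal{C}_0^{0,1\text{-var}}(I,E)$ is the closure, in the $1$-variation norm $\|x\|_{1\text{-var};I}=\sup\sum_i|x_{t_{i+1}}-x_{t_i}|$ (supremum over finite dissections), of the set of infinitely differentiable paths $x:I\to E$ with $x_0=0$. The lift $S_N(x):I\to T_1^N(E)$ of $x$ is the path with $S_N(x)_0=\mathbf{1}$ and $\pi_k\big(S_N(x)_s^{-1}\otimes S_N(x)_t\big)=\int_{s<u_1<\dots<u_k<t}dx_{u_1}\otimes\cdots\otimes dx_{u_k}$ for $s\le t$, $1\le k\le N$. For $\mathbf{x},\mathbf{y}:I\to T_1^N(E)$, $$d_{p\text{-var};I}(\mathbf{x},\mathbf{y})=\max_{k=1,\dots,N}\Big(\sup_{\mathbb{D}}\sum_{t_i\in\mathbb{D}}|\pi_k(\mathbf{x}_{t_i,t_{i+1}}-\mathbf{y}_{t_i,t_{i+1}})|^{p/k}\Big)^{1/p},$$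 supremum over finite dissections of $I$. $\mathcal{C}_0^{0,p\text{-var}}(I,T_1^N(E))$ is the set of continuous $\mathbf{x}:I\to T_1^N(E)$ with $\mathbf{x}_0=\mathbf{1}$ for which there are $x_n\in\mathcal{C}_0^{0,1\text{-var}}(I,E)$ with $d_{p\text{-var};I}(\mathbf{x},S_N(x_n))\to0$; it has the topology of $d_{p\text{-var};I}$. $\mathcal{C}_0^{0,p\text{-var}}(\mathbb{R},T_1^N(E))$ is the set of continuous $\mathbf{x}:\mathbb{R}\to T_1^N(E)$ with $\mathbf{x}|_I\in\mathcal{C}_0^{0,p\text{-var}}(I,T_1^N(E))$ for every compact interval $I\ni0$, with the coarsest topology making all restriction maps $\mathbf{x}\mapsto\mathbf{x}|_I$ continuous, and with its Borel $\sigma$-algebra. A measurable metric dynamical system $(\Omega,\mathcal{F},\mathbb{P},\theta)$ is a probability space with a family $\theta=(\theta_t)_{t\in\mathbb{R}}$ of maps $\Omega\to\Omega$ such that $(\omega,t)\mapsto\theta_t\omega$ is $\mathcal{F}\otimes\mathcal{B}(\mathbb{R})/\mathcal{F}$-measurable, $\theta_0=\mathrm{Id}$, $\theta_{s+t}=\theta_s\circ\theta_t$, and $\mathbb{P}\circ\theta_t^{-1}=\mathbb{P}$ for all $t$. *)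

(* Defs.v *)
From HB Require Import structures.
From mathcomp Require Import all_boot all_order all_algebra.
From mathcomp Require Import all_classical all_reals all_analysis.

Set Implicit Arguments.
Unset Strict Implicit.
Unset Printing Implicit Defensive.

Import Order.TTheory GRing.Theory Num.Theory.
Import numFieldNormedType.Exports.

Local Open Scope classical_set_scope.
Local Open Scope ring_scope.

Definition upd_tuple (T : Type) (k : nat) (v : k.-tuple T) (i : 'I_k) (x : T) :
  k.-tuple T := [tuple if j == i then x else tnth v j | j < k].

Definition multilinear (R : realType) (E V : lmodType R) (k : nat)
    (f : k.-tuple E -> V) : Prop :=
  forall (i : 'I_k) (v : k.-tuple E) (a : R) (x y : E),
    f (upd_tuple v i (a *: x + y)) =
    a *: f (upd_tuple v i x) + f (upd_tuple v i y).

(* The universal property that defines the algebraic tensor power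
   [ten (v_1, ..., v_k) = v_1 (x) ... (x) v_k]. *)
Definition is_tensor_power (R : realType) (E A : lmodType R) (k : nat)
    (ten : k.-tuple E -> A) : Prop :=
  [/\ multilinear ten,
      forall (V : lmodType R) (f : k.-tuple E -> V), multilinear f ->
        exists g : {linear A -> V}, forall v, g (ten v) = f v
    & forall (V : lmodType R) (g h : {linear A -> V}),
        (forall v, g (ten v) = h (ten v)) -> g =1 h].

(* The algebraic tensor powers [alg k] of E with compatible norms, their
   completions [tp k], and the tensor products on both.  The products are
   determined by [amul_ten] and [mul_inj]. *)
Record tensorNorms (R : realType) (E : completeNormedModType R) := TensorNorms {
  alg : nat -> normedModType R ;
  ten : forall k, k.-tuple E -> alg k ;
  tenP : forall k, is_tensor_power (@ten k) ;
  amul : forall i j, alg i -> alg j -> alg (i + j)%N ;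
  amul_bilinear : forall i j, bilinear_for *:%R *:%R (@amul i j) ;
  amul_ten : forall i j (v : i.-tuple E) (w : j.-tuple E),
    amul (ten v) (ten w) = ten (cat_tuple v w) ;
  norm_ten0 : `|ten [tuple]| = 1 ;
  norm_ten1 : forall v : E, `|ten [tuple v]| = `|v| ;
  norm_amulC : forall i j (x : alg i) (y : alg j), `|amul x y| = `|amul y x| ;
  norm_amul : forall i j (x : alg i) (y : alg j), `|amul x y| <= `|x| * `|y| ;
  tp : nat -> completeNormedModType R ;
  inj : forall k, {linear alg k -> tp k} ;
  norm_inj : forall k (x : alg k), `|inj k x| = `|x| ;
  dense_inj : forall k, dense (range (inj k)) ;
  mul : forall i j, tp i -> tp j -> tp (i + j)%N ;
  mul_bilinear : forall i j, bilinear_for *:%R *:%R (@mul i j) ;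
  mul_inj : forall i j (x : alg i) (y : alg j),
    mul (inj i x) (inj j y) = inj (i + j)%N (amul x y) ;
  norm_mul : forall i j (x : tp i) (y : tp j), `|mul x y| <= `|x| * `|y|
}.

Section tensor_product.
Context {R : realType} {E : completeNormedModType R} (T : tensorNorms E).

Definition castp (i j : nat) (e : i = j) (x : tp T i) : tp T j :=
  ecast n (tp T n) e x.

Definition onep : tp T 0 := inj T 0 (ten T [tuple]).

Definition vecp (v : E) : tp T 1 := inj T 1 (ten T [tuple v]).

(* [tprod k x y] is x (x) y seen at level k, and 0 when the levels of x and y
   do not add up to k. *)
Definition tprod (k i j : nat) (x : tp T i) (y : tp T j) : tp T k :=
  if (i + j)%N =P k is ReflectT e then castp e (mul x y) else 0.

Lemma tprodE k i j (e : (i + j)%N = k) (x : tp T i) (y : tp T j) :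
  tprod k x y = castp e (mul x y).
Proof.
by rewrite /tprod; case: eqP => [e'|//]; rewrite (eq_irrelevance e' e).
Qed.

Lemma tprod_neq k i j (x : tp T i) (y : tp T j) :
  (i + j)%N != k -> tprod k x y = 0.
Proof. by rewrite /tprod; case: eqP. Qed.

Lemma norm_tprod k i j (x : tp T i) (y : tp T j) :
  `|tprod k x y| <= `|x| * `|y|.
Proof.
rewrite /tprod; case: eqP => [e|_]; last by rewrite normr0 mulr_ge0.
by case: k / e; exact: norm_mul.
Qed.

Lemma tprod_bilinear k i j : bilinear_for *:%R *:%R (@tprod k i j).
Proof.
rewrite /tprod; split=> [y|x] a u v /=; case: eqP => [e|_];
  rewrite ?scaler0 ?addr0//; case: k / e; rewrite /castp /=.
- exact: (mul_bilinear T i j).1.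
- exact: (mul_bilinear T i j).2.
Qed.

HB.instance Definition _ k i j := @bilinear_isBilinear.Build R _ _ _ _ _
  (@tprod k i j) (@tprod_bilinear k i j).

Lemma tprod_ten k i j (v : i.-tuple E) (w : j.-tuple E)
    (e : (i + j)%N = k) :
  tprod k (inj T i (ten T v)) (inj T j (ten T w)) =
  inj T k (ten T (tcast e (cat_tuple v w))).
Proof. by rewrite (tprodE e); case: k / e; rewrite /= mul_inj amul_ten. Qed.

(* A bounded linear map that vanishes on the elementary tensors is zero. *)
Lemma tensor_ext k (V : normedModType R) (f g : tp T k -> V) (C D : R) :
  linear f -> linear g ->
  (forall x, `|f x| <= C * `|x|) -> (forall x, `|g x| <= D * `|x|) ->
  (forall v, f (inj T k (ten T v)) = g (inj T k (ten T v))) -> f =1 g.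
Proof.
move=> lf lg bf bg fg x.
pose f' := GRing.isLinear.Build _ _ _ _ _ lf.
pose F : {linear tp T k -> V} := HB.pack f f'.
pose g' := GRing.isLinear.Build _ _ _ _ _ lg.
pose G : {linear tp T k -> V} := HB.pack g g'.
have FG y : F (inj T k y) = G (inj T k y).
  have [_ _ U] := tenP T k.
  exact: (U V (F \o inj T k) (G \o inj T k) fg y).
apply/eqP; rewrite -subr_eq0 -normr_le0; apply/ler_addgt0Pr => e e0.
rewrite add0r.
pose K := `|C| + `|D| + 1.
have K0 : 0 < K by rewrite ltr_wpDl// addr_ge0.
have [|z [/= xz [y _ yz]]] := @dense_inj _ _ T k (ball x (e / K)) _ (ball_open _ _).
  by exists x; apply: ballxx; rewrite divr_gt0.
move: xz; rewrite -ball_normE /= => xz.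
have fgz : f z = g z by rewrite -yz; exact: FG.
have -> : f x - g x = f (x - z) - g (x - z).
  have -> : f (x - z) = f x - f z by exact: (raddfB F).
  have -> : g (x - z) = g x - g z by exact: (raddfB G).
  by rewrite fgz opprB addrA subrK.
rewrite (le_trans (ler_normB _ _))//.
apply: (@le_trans _ _ (K * `|x - z|)).
  rewrite /K 2!mulrDl mul1r (le_trans (lerD (bf _) (bg _)))//.
  rewrite -[leLHS]addr0 lerD//.
  by rewrite lerD// ler_wpM2r// ler_norm.
by rewrite mulrC -ler_pdivlMr// ltW.
Qed.

Lemma tprod1x k (x : tp T k) : tprod k onep x = x.
Proof.
apply: (@tensor_ext k _ (tprod k onep) id `|onep| 1 _ _ _ _ _ x).
- by move=> a u v; rewrite linearPr.
- by [].
- by move=> u; exact: norm_tprod.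
- by move=> u; rewrite mul1r.
- move=> v; rewrite (tprod_ten _ _ (add0n k)); congr (inj T k (ten T _)).
  by apply: val_inj; rewrite /= val_tcast.
Qed.

Lemma tprodx1 k (x : tp T k) : tprod k x onep = x.
Proof.
apply: (@tensor_ext k _ (fun x => tprod k x onep) id `|onep| 1 _ _ _ _ _ x).
- by move=> a u v; rewrite linearPl.
- by [].
- by move=> u; rewrite mulrC; exact: norm_tprod.
- by move=> u; rewrite mul1r.
- move=> v; rewrite (tprod_ten _ _ (addn0 k)); congr (inj T k (ten T _)).
  by apply: val_inj; rewrite /= val_tcast /= cats0.
Qed.

Lemma tprodA n m l i j k (x : tp T i) (y : tp T j) (z : tp T k) :
  (i + j)%N = m -> (j + k)%N = l -> (m + k)%N = n ->
  tprod n x (tprod l y z) = tprod n (tprod m x y) z.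
Proof.
move=> ijm jkl mkn.
have iln : (i + l)%N = n by rewrite -mkn -ijm -jkl addnA.
apply: (@tensor_ext i _ (fun x => tprod n x (tprod l y z))
  (fun x => tprod n (tprod m x y) z) `|tprod l y z| (`|y| * `|z|) _ _ _ _ _ x).
- by move=> a u v; rewrite linearPl.
- by move=> a u v; rewrite linearPl linearPl.
- by move=> u; rewrite mulrC; exact: norm_tprod.
- move=> u; rewrite (le_trans (norm_tprod _ _ _))//.
  by rewrite mulrAC ler_wpM2r// mulrC norm_tprod.
move=> {x}p; set x := inj T i _.
apply: (@tensor_ext j _ (fun y => tprod n x (tprod l y z))
  (fun y => tprod n (tprod m x y) z) (`|x| * `|z|) (`|x| * `|z|) _ _ _ _ _ y).
- by move=> a u v; rewrite linearPl linearPr.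
- by move=> a u v; rewrite linearPr linearPl.
- move=> u; rewrite (le_trans (norm_tprod _ _ _))//.
  by rewrite -mulrA ler_wpM2l// mulrC norm_tprod.
- move=> u; rewrite (le_trans (norm_tprod _ _ _))//.
  by rewrite mulrAC ler_wpM2r// norm_tprod.
move=> {y}q; set y := inj T j _.
apply: (@tensor_ext k _ (fun z => tprod n x (tprod l y z))
  (fun z => tprod n (tprod m x y) z) (`|x| * `|y|) `|tprod m x y| _ _ _ _ _ z).
- by move=> a u v; rewrite linearPr linearPr.
- by move=> a u v; rewrite linearPr.
- move=> u; rewrite (le_trans (norm_tprod _ _ _))//.
  by rewrite -mulrA ler_wpM2l// norm_tprod.
- by move=> u; exact: norm_tprod.
move=> r; rewrite (tprod_ten _ _ jkl) (tprod_ten _ _ iln).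
rewrite (tprod_ten _ _ ijm) (tprod_ten _ _ mkn).
congr (inj T n (ten T _)).
by apply: val_inj; rewrite /= !val_tcast /= !val_tcast /= catA.
Qed.

End tensor_product.

Section truncated_group.
Context {R : realType} {E : completeNormedModType R} (T : tensorNorms E)
  (N : nat).

(* (1, g^1, ..., g^N), stored as a sequence of levels that is 0 above N. *)
Record truncGroup := TruncGroup {
  lev :> forall k, tp T k ;
  lev0 : lev 0%N = onep T ;
  lev_gt : forall k, (N < k)%N -> lev k = 0
}.

HB.instance Definition _ := gen_eqMixin truncGroup.
HB.instance Definition _ := gen_choiceMixin truncGroup.

Lemma lev_inj (g h : truncGroup) :
  (forall k, (k <= N)%N -> g k = h k) -> g = h.
Proof.
case: g h => [g g0 gN] [h h0 hN] /= gh.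
have E' : g = h.
  apply: functional_extensionality_dep => k.
  by have [/gh//|kN] := leqP k N; rewrite gN// hN.
by case: h / E' h0 hN {gh} => h0 hN; congr TruncGroup; exact: Prop_irrelevance.
Qed.

Definition tgdist (g h : truncGroup) : R :=
  \big[Num.max/0]_(k < N.+1) `|g k - h k|.

Lemma tgdistxx g : tgdist g g = 0.
Proof.
apply/eqP; rewrite eq_le bigmax_ge_id andbT.
by apply/bigmax_leP; split=> // i _; rewrite subrr normr0.
Qed.

Lemma tgdist_positivity g h : tgdist g h = 0 -> g = h.
Proof.
move=> gh; apply: lev_inj => k kN; apply/eqP; rewrite -subr_eq0 -normr_le0.
rewrite -gh; exact: (le_bigmax _ (fun k : 'I_N.+1 => `|g k - h k|)
  (Ordinal (kN : (k < N.+1)%N))).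
Qed.

Lemma tgdist_sym g h : tgdist g h = tgdist h g.
Proof. by apply: eq_bigr => k _; rewrite distrC. Qed.

Lemma tgdist_triangle h g f : tgdist g f <= tgdist g h + tgdist h f.
Proof.
apply/bigmax_leP; split=> [|k _]; first by rewrite addr_ge0// bigmax_ge_id.
have -> : g k - f k = (g k - h k) + (h k - f k) by rewrite addrA subrK.
rewrite (le_trans (ler_normD _ _))// lerD//.
- exact: (le_bigmax _ (fun k : 'I_N.+1 => `|g k - h k|)).
- exact: (le_bigmax _ (fun k : 'I_N.+1 => `|h k - f k|)).
Qed.

HB.instance Definition _ := @isMetric.Build R truncGroup tgdist
  tgdistxx tgdist_positivity tgdist_sym tgdist_triangle.

Definition onel (k : nat) : tp T k := if k is 0 then onep T else 0.

Lemma onel_gt k : (N < k)%N -> onel k = 0.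
Proof. by case: k. Qed.

Definition tgone : truncGroup := TruncGroup erefl onel_gt.

(* pi_k (g (x) h) = sum_(i <= k) g^(k-i) (x) h^i for k <= N. *)
Definition mull (g h : forall k, tp T k) (k : nat) : tp T k :=
  if (k <= N)%N then \sum_(i < k.+1) tprod k (g (k - i)%N) (h i) else 0.

Lemma mull0 (g h : truncGroup) : mull g h 0 = onep T.
Proof. by rewrite /mull /= big_ord1 subnn !lev0 tprod1x. Qed.

Lemma mull_gt g h k : (N < k)%N -> mull g h k = 0.
Proof. by move=> kN; rewrite /mull leqNgt kN. Qed.

Definition tgmul (g h : truncGroup) : truncGroup :=
  TruncGroup (mull0 g h) (@mull_gt g h).

Fixpoint invl_upto (g : forall k, tp T k) (n : nat) : forall k, tp T k :=
  if n is n'.+1 then fun k =>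
    if (k <= n')%N then invl_upto g n' k
    else - \sum_(i < k) tprod k (g (k - i)%N) (invl_upto g n' i)
  else onel.

(* (g^-1)^0 = 1 and (g^-1)^k = - sum_(i < k) g^(k-i) (x) (g^-1)^i. *)
Definition invl (g : forall k, tp T k) (k : nat) : tp T k :=
  if (k <= N)%N then invl_upto g k k else 0.

Lemma invl0 (g : truncGroup) : invl g 0 = onep T.
Proof. by []. Qed.

Lemma invl_gt g k : (N < k)%N -> invl g k = 0.
Proof. by move=> kN; rewrite /invl leqNgt kN. Qed.

Definition tginv (g : truncGroup) : truncGroup :=
  TruncGroup (invl0 g) (@invl_gt g).

Lemma invl_uptoE g n k : (k <= n)%N -> invl_upto g n k = invl_upto g k k.
Proof.
elim: n => [|n IH]; first by rewrite leqn0 => /eqP ->.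
by rewrite leq_eqVlt => /predU1P[->//|]; rewrite ltnS => kn /=; rewrite kn IH.
Qed.

Lemma invlS g k : (k < N)%N ->
  invl g k.+1 = - \sum_(i < k.+1) tprod k.+1 (g (k.+1 - i)%N) (invl g i).
Proof.
move=> kN; rewrite /invl kN /= ltnn; congr (- _); apply: eq_bigr => i _.
have ik : (i <= k)%N by rewrite -ltnS.
by rewrite (leq_trans ik (ltnW kN)) invl_uptoE.
Qed.

Lemma mull_full (g h : forall k, tp T k) n k : (k <= N)%N -> (k <= n)%N ->
  mull g h k = \sum_(i < n.+1) \sum_(j < n.+1) tprod k (g i) (h j).
Proof.
move=> kN kn; rewrite /mull kN exchange_big /=.
rewrite (big_ord_widen _ (fun i => tprod k (g (k - i)%N) (h i)) (_ : k < n.+1)%N)//.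
rewrite big_mkcond /=; apply: eq_bigr => j _.
case: ifPn => [|]; rewrite ltnS => jk.
  have kj : (k - j < n.+1)%N by rewrite ltnS (leq_trans (leq_subr _ _)).
  rewrite (bigD1 (Ordinal kj)) //= big1 ?addr0// => i ij.
  rewrite tprod_neq//; apply: contra ij => /eqP ijk.
  by apply/eqP/val_inj; rewrite /= -ijk addnK.
rewrite big1// => i _; rewrite tprod_neq//.
by apply: contra jk => /eqP <-; rewrite leq_addl.
Qed.

Lemma tgmulA : associative tgmul.
Proof.
move=> f g h; apply: lev_inj => n nN /=.
pose t3 (a b c : 'I_n.+1) :=
  tprod n (tprod (a + b)%N (f a) (g b)) (h c).
transitivity (\sum_(a < n.+1) \sum_(b < n.+1) \sum_(c < n.+1) t3 a b c).
  rewrite (mull_full _ _ nN (leqnn n)); apply: eq_bigr => a _.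
  rewrite (eq_bigr (fun l : 'I_n.+1 => \sum_(b < n.+1) \sum_(c < n.+1)
    tprod n (f a) (tprod l (g b) (h c)))); last first.
    move=> l _; have ln : (l <= n)%N by rewrite -ltnS.
    rewrite (mull_full _ _ (leq_trans ln nN) ln) linear_sumr.
    by apply: eq_bigr => b _; rewrite linear_sumr.
  rewrite exchange_big /=; apply: eq_bigr => b _.
  rewrite exchange_big /=; apply: eq_bigr => c _.
  have [e|ne] := eqVneq (a + b + c)%N n.
    have bc : (b + c < n.+1)%N by rewrite ltnS -[leqRHS]e -addnA leq_addl.
    rewrite (bigD1 (Ordinal bc)) //= big1 => [|l lbc].
      by rewrite addr0 /t3 (@tprodA _ _ _ _ (a + b)%N).
    rewrite [tprod l _ _]tprod_neq ?linear0r//.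
    by apply: contra lbc => /eqP bcl; apply/eqP/val_inj.
  rewrite /t3 [RHS]tprod_neq// big1// => l _.
  have [bcl|] := eqVneq (b + c)%N l; last first.
    by move=> bcl; rewrite [tprod l _ _]tprod_neq ?linear0r.
  by rewrite tprod_neq// -bcl addnA.
rewrite (mull_full _ _ nN (leqnn n)).
rewrite [RHS](eq_bigr (fun m : 'I_n.+1 => \sum_(c < n.+1) \sum_(a < n.+1)
    \sum_(b < n.+1) tprod n (tprod m (f a) (g b)) (h c))); last first.
  move=> m _; apply: eq_bigr => c _; have mn : (m <= n)%N by rewrite -ltnS.
  rewrite (mull_full _ _ (leq_trans mn nN) mn) linear_sumlz.
  by apply: eq_bigr => a _; rewrite linear_sumlz.
rewrite [RHS]exchange_big /=.
under eq_bigr do rewrite exchange_big /=.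
rewrite exchange_big /=; apply: eq_bigr => c _.
rewrite [RHS]exchange_big /=; apply: eq_bigr => a _.
rewrite [RHS]exchange_big /=; apply: eq_bigr => b _.
have [e|ne] := eqVneq (a + b + c)%N n.
  have ab : (a + b < n.+1)%N by rewrite ltnS -[leqRHS]e leq_addr.
  rewrite (bigD1 (Ordinal ab)) //= big1 => [|m mab]; first by rewrite addr0.
  rewrite [tprod m _ _]tprod_neq ?linear0l//.
  by apply: contra mab => /eqP abm; apply/eqP/val_inj.
rewrite /t3 tprod_neq// big1// => m _.
have [abm|] := eqVneq (a + b)%N m; last first.
  by move=> abm; rewrite [tprod m _ _]tprod_neq ?linear0l.
by rewrite tprod_neq// -abm.
Qed.

Lemma tgmul1g : left_id tgone tgmul.
Proof.
move=> g; apply: lev_inj => k kN; rewrite /= /mull kN big_ord_recr /= subnn.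
rewrite tprod1x big1 ?add0r// => i _.
have : (0 < k - i)%N by rewrite subn_gt0.
by case: (k - i)%N => // j _; rewrite linear0l.
Qed.

Lemma tgmulg1 : right_id tgone tgmul.
Proof.
move=> g; apply: lev_inj => k kN; rewrite /= /mull kN big_ord_recl /= subn0.
by rewrite tprodx1 big1 ?addr0// => i _; rewrite linear0r.
Qed.

Lemma tgmulgV : right_inverse tgone tginv tgmul.
Proof.
move=> g; apply: lev_inj => -[|k] kN /=.
  exact: mull0 g (tginv g).
rewrite /mull kN big_ord_recr /= subnn lev0 tprod1x.
by rewrite [X in _ + X](@invlS g k kN) subrr.
Qed.

Lemma tgmulVg : left_inverse tgone tginv tgmul.
Proof.
move=> g; rewrite -[LHS]tgmulg1 -{1}(tgmulgV (tginv g)).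
by rewrite tgmulA -(tgmulA (tginv g) g) tgmulgV tgmulg1 tgmulgV.
Qed.

HB.instance Definition _ := @isGroup.Build truncGroup tgone tginv tgmul
  tgmulA tgmul1g tgmulg1 tgmulVg tgmulgV.

End truncated_group.

Section paths.
Context {R : realType} {E : completeNormedModType R} (T : tensorNorms E)
  (N : nat).

Let G := truncGroup T N.

Definition increment (x : R -> G) (s t : R) : G := ((x s)^-1 * x t)%g.

(* Paths on [a, b] are represented by total functions on R of which the
   following definitions only use the values on [a, b].  The derivatives
   [D n] at the end points are one-sided. *)
Definition smooth_on (a b : R) (x : R -> E) : Prop :=
  exists D : nat -> R -> E,
    (forall t, t \in `[a, b] -> D 0%N t = x t) /\
    forall n t, t \in `[a, b] ->
      h^-1 *: (D n (t + h) - D n t) @[h --> within [set h | t + h \in `[a, b]] 0^']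
        --> D n.+1 t.

Definition one_var (a b : R) (x : R -> E) : \bar R :=
  ereal_sup [set (\sum_(i < size s)
      `|x (nth b (a :: s) i.+1) - x (nth b (a :: s) i)|)%:E
    | s in itv_partition a b].

(* C_0^{0,1-var}([a, b], E) *)
Definition C01var (a b : R) (x : R -> E) : Prop :=
  x 0 = 0 /\ forall e, 0 < e -> exists y : R -> E,
    [/\ smooth_on a b y, y 0 = 0 & (one_var a b (fun t => x t - y t)%R < e%:E)%E].

(* v is the Riemann-Stieltjes integral of y (x) dx over [a, b]: the limit of
   the sums of y(u_i) (x) (x(t_{i+1}) - x(t_i)), t_i <= u_i <= t_{i+1}, as the
   mesh of (t_i) goes to 0. *)
Definition is_RSint (k : nat) (y : R -> tp T k) (x : R -> E) (a b : R)
    (v : tp T k.+1) : Prop :=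
  forall e, 0 < e -> exists2 d, 0 < d &
    forall (s : seq R) (u : nat -> R), itv_partition a b s ->
      (forall i, (i < size s)%N ->
         [/\ nth b (a :: s) i <= u i, u i <= nth b (a :: s) i.+1
           & nth b (a :: s) i.+1 - nth b (a :: s) i < d]) ->
      `|v - \sum_(i < size s) castp (addn1 k)
          (mul (y (u i))
             (vecp T (x (nth b (a :: s) i.+1) - x (nth b (a :: s) i))))| < e.

(* The integral of dx_{u_1} (x) ... (x) dx_{u_k} over s < u_1 < ... < u_k < t,
   integrating u_k last. *)
Fixpoint iterint (x : R -> E) (s : R) (k : nat) : R -> tp T k :=
  match k with
  | 0 => fun=> onep T
  | k'.+1 => fun t => xget 0 [set v | is_RSint (iterint x s k') x s t v]
  end.

(* X = S_N(x) on [a, b] *)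
Definition is_lift (a b : R) (x : R -> E) (X : R -> G) : Prop :=
  X 0 = 1%g /\
  forall s t k, a <= s -> s <= t -> t <= b -> (1 <= k <= N)%N ->
    increment X s t k = iterint x s k t.

Definition dpvar (p a b : R) (x y : R -> G) : \bar R :=
  \big[maxe/0%E]_(1 <= k < N.+1)
    (ereal_sup [set (\sum_(i < size s)
         `|increment x (nth b (a :: s) i) (nth b (a :: s) i.+1) k -
           increment y (nth b (a :: s) i) (nth b (a :: s) i.+1) k|
           `^ (p / k%:R))%:E
       | s in itv_partition a b] `^ p^-1)%E.

(* x restricted to [a, b] is in C_0^{0,p-var}([a, b], T_1^N(E)) *)
Definition C0pvar (p a b : R) (x : R -> G) : Prop :=
  [/\ {within `[a, b], continuous x}, x 0 = 1%g
    & exists (xn : nat -> R -> E) (Xn : nat -> R -> G),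
        (forall n, C01var a b (xn n) /\ is_lift a b (xn n) (Xn n)) /\
        dpvar p a b x (Xn n) @[n --> \oo] --> 0%E].

End paths.

(* A compact interval [lo, hi] that contains 0. *)
Record interval0 (R : realType) := Interval0 {
  lo : R ; hi : R ; lo_le0 : lo <= 0 ; hi_ge0 : 0 <= hi
}.

Section path_spaces.
Context {R : realType} {E : completeNormedModType R} (T : tensorNorms E)
  (N : nat) (p : R).

Let G := truncGroup T N.

Definition restrict_path (J : interval0 R) (x : R -> G) : R -> G :=
  patch (fun=> 1%g) `[lo J, hi J] x.

(* C_0^{0,p-var}(J, T_1^N(E)); a path on J is encoded by its extension to R
   that is 1 outside J. *)
Record pathOn (J : interval0 R) := PathOn {
  path_on :> R -> G ;
  path_on_ext : restrict_path J path_on = path_on ;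
  path_onP : C0pvar p (lo J) (hi J) path_on
}.

HB.instance Definition _ J := gen_eqMixin (pathOn J).
HB.instance Definition _ J := gen_choiceMixin (pathOn J).

(* The open sets of the distance [dpvar]. *)
Definition path_open (J : interval0 R) (U : set (pathOn J)) : Prop :=
  forall x, U x -> exists2 e, 0 < e &
    forall y : pathOn J, (dpvar p (lo J) (hi J) x y < e%:E)%E -> U y.

Lemma path_openT J : @path_open J setT.
Proof. by move=> x _; exists 1. Qed.

Lemma path_openI J : setI_closed (@path_open J).
Proof.
move=> A B oA oB x [/oA[e e0 He] /oB[f f0 Hf]].
exists (Num.min e f); first by rewrite lt_min e0.
by move=> y; rewrite EFin_min lt_min => /andP[/He ? /Hf ?].
Qed.

Lemma path_open_bigU J (I : Type) (F : I -> set (pathOn J)) :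
  (forall i, path_open (F i)) -> path_open (\bigcup_i F i).
Proof. by move=> oF x [i _ /oF[e e0 He]]; exists e => // y /He; exists i. Qed.

HB.instance Definition _ J := @isOpenTopological.Build (pathOn J)
  (@path_open J) (@path_openT J) (@path_openI J) (@path_open_bigU J).

Lemma restrict_path_id J (x : R -> G) :
  restrict_path J (restrict_path J x) = restrict_path J x.
Proof.
by apply/funext => t; rewrite /restrict_path /patch; case: ifP => // ->.
Qed.

(* C_0^{0,p-var}(R, T_1^N(E)); [p1] is a parameter so that the type has a
   canonical point, the constant path, as measurable types require. *)
Record roughPath (p1 : 1 <= p) := RoughPath {
  rpath :> R -> G ;
  rpath_continuous : continuous rpath ;
  rpathP : forall J : interval0 R,
    C0pvar p (lo J) (hi J) (restrict_path J rpath)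
}.

Variable p1 : 1 <= p.

Definition restriction (J : interval0 R) (x : roughPath p1) : pathOn J :=
  PathOn (restrict_path_id J x) (rpathP x J).

HB.instance Definition _ := gen_eqMixin (roughPath p1).
HB.instance Definition _ := gen_choiceMixin (roughPath p1).

(* The coarsest topology that makes all the restrictions continuous. *)
HB.instance Definition _ := @isSubBaseTopological.Build (roughPath p1)
  (set (roughPath p1))
  [set A | exists J (U : set (pathOn J)), open U /\ A = restriction J @^-1` U]
  id.

Lemma fine_partition (d a b : R) : 0 < d -> a <= b ->
  exists2 s, itv_partition a b s & forall i, (i < size s)%N ->
    nth b (a :: s) i <= nth b (a :: s) i.+1 /\
    nth b (a :: s) i.+1 - nth b (a :: s) i < d.
Proof.
move=> d0 ab.
have : b - a < (Num.truncn ((b - a) / (d / 2))).+1%:R * (d / 2).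
  by rewrite -ltr_pdivrMr ?truncnS_gt// divr_gt0.
move: (_.+1) => n; elim: n a ab => [a ab|n IH a ab ban].
  by rewrite mul0r subr_lt0 ltNge ab.
have [ba|dba] := ltP (b - a) d.
  have [{}ab|{}ba'] := ltP a b; last first.
    exists [::] => //; split=> //=.
    by apply/eqP/le_anti; rewrite ab ba'.
  exists [:: b]; first exact: itv_partition1.
  by case=> // _ /=; rewrite ltW.
pose c := a + d / 2.
have ac : a < c by rewrite ltrDl divr_gt0.
have cb : c <= b.
  rewrite /c addrC -lerBrDr (le_trans _ dba)// ler_pdivrMr//.
  by rewrite ler_peMr ?ler1n// ltW.
have [|s [ps ls] sd] := IH c cb.
  rewrite /c opprD addrA ltrBlDr (lt_le_trans ban)//.
  by rewrite -[X in _ + X]mul1r -mulrDl -natr1.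
exists (c :: s); first by split=> //=; rewrite ac.
case=> [_|i /sd] //=; split; first exact: ltW.
by rewrite /c addrAC subrr add0r ltr_pdivrMr// ltr_pMr// ltr1n.
Qed.

Lemma vecp0 : vecp T 0 = 0.
Proof.
by apply/eqP; rewrite -normr_le0 /vecp norm_inj norm_ten1 normr0.
Qed.

Lemma RSint_cst0 k (y : R -> tp T k) (a b : R) (v : tp T k.+1) : a <= b ->
  is_RSint y (fun=> 0) a b v -> v = 0.
Proof.
move=> ab yv; apply/eqP; rewrite -normr_le0; apply/ler_addgt0Pr => e e0.
have [d d0 {}yv] := yv _ e0; have [s sab sd] := fine_partition d0 ab.
have := yv s (fun i => nth b (a :: s) i) sab.
rewrite big1 => [|i _]; last first.
  by rewrite subr0 vecp0 -(tprodE (addn1 k)) linear0r.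
rewrite subr0 add0r => H; apply/ltW/H => i /sd[? ?]; split=> //.
Qed.

Lemma iterint_cst0 (s : R) k (t : R) : s <= t ->
  iterint T (fun=> 0) s k t = onel T k.
Proof.
case: k => // k st /=; apply: xget_unique => /=; last first.
  by move=> v; exact: RSint_cst0.
move=> e e0; exists 1 => // q u _ _; rewrite big1 => [|i _].
  by rewrite subr0 normr0.
by rewrite subr0 vecp0 -(tprodE (addn1 k)) linear0r.
Qed.

Lemma C0pvar_cst1 (a b : R) : a <= b -> C0pvar p a b (fun=> 1%g : G).
Proof.
move=> ab; split=> //; first exact: cst_continuous.
exists (fun _ _ => 0), (fun _ _ => 1%g); split=> [n|].
  split; first split=> // e e0.
    exists (fun=> 0); split=> //.
      exists (fun _ _ => 0); split=> // m t _.
      by under eq_cvg do rewrite subrr scaler0; exact: cvg_cst.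
    rewrite (@le_lt_trans _ _ 0%E) ?lte_fin// ge_ereal_sup// => _ [q _ <-].
    by rewrite big1 ?lexx// => i _; rewrite !subrr normr0.
  split=> // s t k _ st _ /andP[k0 _].
  by rewrite iterint_cst0// /increment mulVg.
have p0 : 0 < p by rewrite (lt_le_trans _ p1).
suff -> : dpvar p a b (fun=> 1%g : G) (fun=> 1%g : G) = 0%E by exact: cvg_cst.
rewrite /dpvar big_seq; apply: (big_ind (fun z => z = 0%E)) => //.
  by move=> _ _ -> ->; rewrite maxxx.
move=> k; rewrite mem_index_iota => /andP[k0 _].
set S := (X in ereal_sup X); suff -> : S = [set 0%E].
  by rewrite ereal_sup1 poweR_EFin powR0// gt_eqF// invr_gt0.
have Z q : \sum_(i < size q) `|increment (fun=> 1%g : G) (nth b (a :: q) i)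
    (nth b (a :: q) i.+1) k - increment (fun=> 1%g : G) (nth b (a :: q) i)
    (nth b (a :: q) i.+1) k| `^ (p / k%:R) = 0.
  rewrite big1// => i _; rewrite subrr normr0 powR0// gt_eqF//.
  by rewrite divr_gt0// ltr0n.
apply/seteqP; split=> [_ [q _ <-]|_ ->]; first by rewrite Z.
by have [q qab _] := fine_partition ltr01 ab; exists q => //; rewrite Z.
Qed.

Lemma restrict_path_cst1 J :
  restrict_path J (fun=> 1%g : G) = (fun=> 1%g : G).
Proof. by apply/funext => t; rewrite /restrict_path /patch; case: ifP. Qed.

Lemma cst1P (J : interval0 R) :
  C0pvar p (lo J) (hi J) (restrict_path J (fun=> 1%g : G)).
Proof.
rewrite restrict_path_cst1; apply: C0pvar_cst1.
exact: le_trans (lo_le0 J) (hi_ge0 J).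
Qed.

HB.instance Definition _ := isPointed.Build (roughPath p1)
  (RoughPath p1 (@cst_continuous R G (1%g : G)) cst1P).

Definition borelRoughPath := g_sigma_algebraType (@open (roughPath p1)).

End path_spaces.

Section dynamics.
Context {R : realType} {d : measure_display} {Omega : measurableType d}
  (P : probability Omega R).

Definition metric_dynamical_system (theta : R -> Omega -> Omega) : Prop :=
  [/\ measurable_fun [set: Omega * R] (fun z => theta z.2 z.1),
      theta 0 = id,
      forall s t, theta (s + t) = theta s \o theta t
    & forall t (A : set Omega), measurable A -> P (theta t @^-1` A) = P A].

Context {E : completeNormedModType R} {T : tensorNorms E} {N : nat} {p : R}
  {p1 : 1 <= p}.

(* The law of the random path h |-> X_{t0, t0 + h} on the Borel sets of
   [roughPath]. *)
Definition increment_law (X : {RV P >-> borelRoughPath T N p1}) (t0 : R)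
    (B : set (borelRoughPath T N p1)) : \bar R :=
  P [set w | exists2 y : roughPath T N p1,
       B y & rpath y = fun h => increment (X w : roughPath T N p1) t0 (t0 + h)].

Definition stationary_increments (X : {RV P >-> borelRoughPath T N p1}) : Prop :=
  forall t0 t1 (B : set (borelRoughPath T N p1)), measurable B ->
    increment_law X t0 B = increment_law X t1 B.

Definition cocycle (theta : R -> Omega -> Omega)
    (X : {RV P >-> borelRoughPath T N p1}) : Prop :=
  forall w s t, (X w : roughPath T N p1) (s + t) =
    ((X w : roughPath T N p1) s * (X (theta s w) : roughPath T N p1) t)%g.

End dynamics.

(* Main.v *)
Require Import Defs.
From HB Require Import structures.
From mathcomp Require Import all_boot all_order all_algebra.
From mathcomp Require Import all_classical all_reals all_analysis.
From mathcomp Require Import ring lra.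

(** The dynamical system is the canonical one: [Omega] is the path space with
    its Borel sets, [P] is the law of [Xbar], [X] is the identity, and
    [theta t] is the Wiener shift [wiener_shift t], which maps [w] to the path
    [h |-> w_t^-1 w_(t+h)].  The cocycle property is then an identity in the
    group, the flow property too, and the invariance of [P] is the stationarity
    of the increments of [Xbar].

    Two points need an argument.  The shifted path must belong to the path
    space: if [w] is approximated by lifts of paths [x_n], its shift is
    approximated by lifts of the paths [x_n(t + .) - x_n(t)], because iterated
    integrals are invariant under translation ([iterint_shift],
    [is_lift_translate]).  And [(w, t) |-> wiener_shift t w] must be jointly
    measurable although the path space need not be separable.  The line is
    second countable, so an open set of the product is a countable union of
    boxes, and joint continuity is enough ([measurable_wiener_shift]).

    Joint continuity reduces to the continuity of [t |-> wiener_shift t Y] for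
    the lift [Y] of a single path [x], since lifts are dense and the shift does
    not increase the distance, up to an enlargement of the interval
    ([wiener_shift_near]).  For the lift, [x] is the sum of a smooth path,
    whose translation is Lipschitz in 1-variation because its second derivative
    is bounded ([smooth_on_control]), and of a path of small 1-variation.  Hence
    the first levels of two close translates are close in 1-variation, and it
    remains to pass to the higher levels.

    The increments of a lift are multiplicative because they are increments of
    a path in a group, and their level [k] is bounded by a product of [k]
    increments of controls of [x], including the integrals that do not exist
    and are 0 by convention ([iterint_bound]).  For [k >= 2] the sums of the levels [k] along fine
    partitions therefore tend to 0, and the multiplicativity expresses the
    level [k] over an interval by lower levels only.  So closeness of the first
    levels propagates to all levels ([lift_controlled_dist]), in a form that
    bounds the p-variation distance ([pvar_le_lift]). *)

Set Implicit Arguments.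
Unset Strict Implicit.
Unset Printing Implicit Defensive.

Import Order.TTheory GRing.Theory Num.Theory.
Import numFieldNormedType.Exports.

Local Open Scope classical_set_scope.
Local Open Scope ring_scope.

Lemma subrACA (V : zmodType) (x y z t : V) :
  (x - y) - (z - t) = (x - z) - (y - t).
Proof. by rewrite !opprB addrACA [RHS]addrACA [- y - z]addrC. Qed.

(** * Sums along partitions *)

Section partition_sums.
Context {R : realType}.
Implicit Types (F G : R -> R -> R) (s : seq R) (a b : R).

(** Recursive in the partition, unlike the indexed sums, so that partitions can
    be cut and concatenated. *)
Fixpoint psum F a s : R :=
  if s is c :: s' then F a c + psum F c s' else 0.

Lemma psumE F a b s :
  \sum_(i < size s) F (nth b (a :: s) i) (nth b (a :: s) i.+1) = psum F a s.
Proof.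
elim: s a => [|c s IH] a; first by rewrite big_ord0.
by rewrite big_ord_recl /= -IH.
Qed.

Lemma itv_partition_consE a b c s :
  itv_partition a b (c :: s) -> a < c /\ itv_partition c b s.
Proof. by case=> /= /andP[ac cs] l. Qed.

Lemma psum_le F G a b s : itv_partition a b s ->
  (forall u v, a <= u -> u <= v -> v <= b -> F u v <= G u v) ->
  psum F a s <= psum G a s.
Proof.
elim: s a => //= c s IH a /itv_partition_consE[ac cs] FG.
have cb := itv_partition_le cs.
rewrite lerD ?FG ?(ltW ac)//; apply: IH => // u v cu uv vb.
by apply: FG => //; rewrite (le_trans (ltW ac)).
Qed.

Lemma psum_telescope c (B : R -> R) a b s : itv_partition a b s ->
  psum (fun u v => c * (B v - B u)) a s = c * (B b - B a).
Proof.
elim: s a => [|d s IH] a.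
  by move=> /itv_partition_nil ->; rewrite subrr mulr0.
move=> /itv_partition_consE[_ ds] /=.
by rewrite (IH d)// -mulrDr addrC addrA subrK.
Qed.

Lemma psumD F G a s :
  psum (fun u v => F u v + G u v) a s = psum F a s + psum G a s.
Proof. by elim: s a => [|c s IH] a /=; rewrite ?addr0// IH addrACA. Qed.

Lemma psumZ k F a s : psum (fun u v => k * F u v) a s = k * psum F a s.
Proof. by elim: s a => [|c s IH] a /=; rewrite ?mulr0// IH mulrDr. Qed.

Lemma psum_ge0 F a s : (forall u v, 0 <= F u v) -> 0 <= psum F a s.
Proof. by move=> F0; elim: s a => //= c s IH a; rewrite addr_ge0. Qed.

Lemma psum_cat F a s1 s2 :
  psum F a (s1 ++ s2) = psum F a s1 + psum F (last a s1) s2.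
Proof. by elim: s1 a => [|c s IH] a /=; rewrite ?add0r// IH addrA. Qed.

Lemma psum_map F t a s :
  psum (fun u v => F (t + u) (t + v)) a s = psum F (t + a) (map (+%R t) s).
Proof. by elim: s a => //= c s IH a; rewrite IH. Qed.

Lemma itv_partition_map t a b s : itv_partition a b s ->
  itv_partition (t + a) (t + b) (map (+%R t) s).
Proof.
elim: s a => [|c s IH] a; first by move=> /itv_partition_nil ->.
move=> /itv_partition_consE[ac /IH[/= p l]]; split=> //=.
by rewrite ltrD2l ac.
Qed.

(** The partition is translated and completed by points outside of its
    interval, which only adds nonnegative terms. *)
Lemma psum_extend F (t a b a' b' : R) s : (forall u v, 0 <= F u v) ->
  itv_partition a b s -> a' <= t + a -> t + b <= b' ->
  exists2 s', itv_partition a' b' s' &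
    psum (fun u v => F (t + u) (t + v)) a s <= psum F a' s'.
Proof.
move=> F0 ps a'a bb'.
have [s1 p1 _] := fine_partition ltr01 a'a.
have [s3 p3 _] := fine_partition ltr01 bb'.
have ps2 := itv_partition_map t ps.
exists (s1 ++ (map (+%R t) s ++ s3)).
  exact: itv_partition_cat p1 (itv_partition_cat ps2 p3).
rewrite psum_map !psum_cat; case: p1 => _ /eqP ->.
by rewrite -[leLHS]add0r lerD ?psum_ge0// lerDl psum_ge0.
Qed.

End partition_sums.

(** * Controls of bounded variation *)

Section controls.
Context {R : realType} {V : normedModType R}.
Implicit Types (x y : R -> V) (F G : R -> R).

(** Bounded variation, through an additive upper bound of the jumps: additive
    bounds telescope along partitions, and are added and translated as
    functions. *)
Definition controlled (a b : R) F x : Prop :=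
  forall u v, a <= u -> u <= v -> v <= b -> `|x v - x u| <= F v - F u.

Lemma controlled_nd a b F x u v : controlled a b F x ->
  a <= u -> u <= v -> v <= b -> F u <= F v.
Proof.
by move=> Fx au uv vb; rewrite -subr_ge0 (le_trans _ (Fx _ _ au uv vb)).
Qed.

Lemma controlledD a b F G x y : controlled a b F x -> controlled a b G y ->
  controlled a b (fun t => F t + G t) (fun t => x t + y t).
Proof.
move=> Fx Gy u v au uv vb; rewrite !opprD addrACA [leRHS]addrACA.
by rewrite (le_trans (ler_normD _ _))// lerD ?Fx ?Gy.
Qed.

Lemma controlledN a b F x : controlled a b F x ->
  controlled a b F (fun t => - x t).
Proof. by move=> Fx u v au uv vb; rewrite -opprD normrN Fx. Qed.

Lemma controlled_shift a b a' b' t F x : controlled a' b' F x ->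
  a' <= t + a -> t + b <= b' ->
  controlled a b (fun u => F (t + u)) (fun u => x (t + u)).
Proof.
move=> Fx a'a bb' u v au uv vb; apply: Fx; rewrite ?lerD2l//.
- by rewrite (le_trans a'a)// lerD2l.
- by rewrite (le_trans _ bb')// lerD2l.
Qed.

Lemma controlled_sub a b a' b' F x : controlled a' b' F x ->
  a' <= a -> b <= b' -> controlled a b F x.
Proof.
move=> Fx a'a bb' u v au uv vb; apply: Fx => //; first exact: le_trans au.
exact: le_trans bb'.
Qed.

End controls.

Section one_variation.
Context {R : realType} {E : completeNormedModType R}.
Implicit Types (x : R -> E).

Let jump x (u v : R) : R := `|x v - x u|.

Lemma one_varE a b x :
  one_var a b x =
  ereal_sup [set (psum (jump x) a s)%:E | s in itv_partition a b].
Proof. by congr ereal_sup; apply: eq_imagel => s _; rewrite -(psumE _ a b). Qed.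

(** The variation up to a running end point is a control. *)
Lemma one_var_control a b x e : a <= b -> (one_var a b x < e%:E)%E ->
  exists2 F : R -> R, controlled a b F x & F b - F a < e.
Proof.
move=> ab; rewrite one_varE => Ve.
have ub u v s : a <= u -> u <= v -> v <= b -> itv_partition a u s ->
    exists2 s', itv_partition a v s' &
      psum (jump x) a s + `|x v - x u| <= psum (jump x) a s'.
  move=> au uv vb pu.
  have [uv'|vu] := ltP u v; last first.
    have -> : v = u by apply/le_anti/andP.
    by exists s => //; rewrite subrr normr0 addr0.
  exists (s ++ [:: v]); first exact/(itv_partition_cat pu)/itv_partition1.
  by rewrite psum_cat /= addr0; case: pu => _ /eqP ->.
pose V u := ereal_sup [set (psum (jump x) a s)%:E | s in itv_partition a u].
have Vge0 u : a <= u -> (0 <= V u)%E.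
  move=> au; have [s ps _] := fine_partition ltr01 au.
  apply: (@le_trans _ _ (psum (jump x) a s)%:E).
    by rewrite lee_fin psum_ge0// => *; exact: normr_ge0.
  by apply: ereal_sup_ubound; exists s.
have Vstep u v : a <= u -> u <= v -> v <= b ->
    (V u + `|x v - x u|%:E <= V v)%E.
  move=> au uv vb; rewrite -leeBrDr//; apply: ge_ereal_sup => _ [s ps <-].
  rewrite leeBrDr// -EFinD.
  have [s' ps' le_s'] := ub u v s au uv vb ps.
  apply: (@le_trans _ _ (psum (jump x) a s')%:E); first by rewrite lee_fin.
  by apply: ereal_sup_ubound; exists s'.
have Vfin u : a <= u -> u <= b -> V u \is a fin_num.
  move=> au ub'; rewrite ge0_fin_numE ?Vge0//.
  apply: (@le_lt_trans _ _ (V b)); last by rewrite (lt_trans Ve) ?ltry.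
  by apply: le_trans (Vstep u b au ub' (lexx b)); rewrite leeDl// lee_fin.
exists (fine \o V) => [u v au uv vb|] /=.
  have vV := Vfin v (le_trans au uv) vb; have uV := Vfin u au (le_trans uv vb).
  rewrite lerBrDr -lee_fin EFinD !fineK// addeC; exact: Vstep.
rewrite (@le_lt_trans _ _ (fine (V b)))//.
  by rewrite lerBlDr lerDl fine_ge0// Vge0.
by rewrite -lte_fin fineK// Vfin.
Qed.

Lemma one_var_shift (t a b a' b' : R) x (c : E) : a' <= t + a -> t + b <= b' ->
  (one_var a b (fun u => x (t + u) - c)%R <= one_var a' b' x)%E.
Proof.
move=> a'a bb'; rewrite !one_varE; apply: ge_ereal_sup => _ [s ps <-].
have [|s' ps' le_s'] := @psum_extend _ (jump x) t a b a' b' s _ ps a'a bb'.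
  by move=> *; exact: normr_ge0.
apply: (@le_trans _ _ (psum (jump x) a' s')%:E); last first.
  by apply: ereal_sup_ubound; exists s'.
rewrite lee_fin (le_trans _ le_s')//; apply: (psum_le ps) => u v _ _ _.
by rewrite /jump opprB addrA subrK.
Qed.

End one_variation.

(** * Smooth paths *)

Section mean_value.
Context {R : realType} {V : normedModType R}.
Implicit Types (f g : R -> V) (a b : R).

(** Differentiability relative to [[a, b]], hence one-sided at the end points,
    written without a quotient so that [u = t] needs no exception. *)
Definition deriv_on a b f g : Prop :=
  forall t, a <= t <= b -> forall e, 0 < e -> exists2 d, 0 < d &
    forall u, a <= u <= b -> `|u - t| < d ->
      `|f u - f t - (u - t) *: g t| <= e * `|u - t|.

Lemma cvg_deriv_on a b f g :
  (forall t, t \in `[a, b] ->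
     h^-1 *: (f (t + h) - f t) @[h --> within [set h | t + h \in `[a, b]] 0^']
       --> g t) -> deriv_on a b f g.
Proof.
move=> fg t tab e e0; have /cvgrPdist_le/(_ e e0) := fg t tab.
rewrite /prop_near1/= /within /= => /nbhs_ballP[d /= d0 H].
exists d => // u uab utd.
have [->|ut] := eqVneq u t; first by rewrite !subrr scale0r subr0 !normr0 mulr0.
have ut0 : u - t != 0 by rewrite subr_eq0.
have := H (u - t); rewrite -ball_normE /= sub0r normrN utd.
rewrite [t + _]addrC subrK => /(_ isT ut0 uab) le_e.
have -> : f u - f t - (u - t) *: g t =
    - ((u - t) *: (g t - (u - t)^-1 *: (f u - f t))).
  by rewrite scalerBr scalerA divff// scale1r opprB.
by rewrite normrN normrZ mulrC ler_wpM2r.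
Qed.

Lemma deriv_on_lip a b f g M : deriv_on a b f g ->
  (forall t, a <= t <= b -> `|g t| <= M) ->
  forall t, a <= t <= b -> forall M', M < M' -> exists2 d, 0 < d &
    forall u, a <= u <= b -> `|u - t| < d -> `|f u - f t| <= M' * `|u - t|.
Proof.
move=> fg gM t tab M' MM'.
have [|d d0 H] := fg t tab (M' - M); first by rewrite subr_gt0.
exists d => // u uab utd.
rewrite -[f u - f t](subrK ((u - t) *: g t)) (le_trans (ler_normD _ _))//.
rewrite -[M' in leRHS](subrK M) mulrDl lerD ?H// normrZ mulrC.
by rewrite ler_wpM2r// gM.
Qed.

(** The mean value inequality: the last point up to which the bound holds
    cannot lie before the end of the interval. *)
Lemma mean_value_control a b f g M : deriv_on a b f g ->
  (forall t, a <= t <= b -> `|g t| <= M) ->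
  controlled a b (fun t => M * t) f.
Proof.
move=> fg gM u v au uv vb; apply/ler_addgt0Pr => e e0.
rewrite -mulrBr.
have [->|neq_uv] := eqVneq u v; first by rewrite !subrr normr0 mulr0 add0r ltW.
have {neq_uv} vu0 : 0 < v - u by rewrite subr_gt0 lt_neqAle neq_uv.
pose M' := M + e / (v - u).
have -> : M * (v - u) + e = M' * (v - u).
  by rewrite /M' mulrDl divfK// gt_eqF.
have MM' : M < M' by rewrite ltrDl divr_gt0.
pose S := [set t | (u <= t <= v) && (`|f t - f u| <= M' * (t - u))].
have Su : S u by rewrite /S /= lexx uv !subrr normr0 mulr0 lexx.
have hS : has_sup S.
  by split; [exists u|exists v => t /andP[/andP[]]].
set c := sup S.
have uc : u <= c by apply: ub_le_sup => //; exact: hS.2.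
have cv : c <= v by apply: ge_sup; [exists u|move=> t /andP[/andP[]]].
have cab : a <= c <= b by rewrite (le_trans au)//= (le_trans cv).
have [d d0 Hd] := deriv_on_lip fg gM cab MM'.
have Sc : S c.
  have [t St tc] := sup_adherent d0 hS.
  have t_c : t <= c by apply: ub_le_sup => //; exact: hS.2.
  have /andP[/andP[ut tv] tM] := St.
  rewrite /S /= uc cv /=.
  rewrite -[f c](subrK (f t)) -[_ + _ - f u]addrA (le_trans (ler_normD _ _))//.
  have -> : M' * (c - u) = M' * `|t - c| + M' * (t - u).
    by rewrite -mulrDr distrC ger0_norm ?subr_ge0// addrA subrK.
  rewrite lerD// distrC; apply: Hd.
    by rewrite (le_trans au)//= (le_trans tv).
  by rewrite distrC ger0_norm ?subr_ge0// ltrBlDr addrC -ltrBlDr.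
have [vc|cv'] := leP v c.
  by have <- : c = v; [apply/le_anti/andP|case/andP: Sc].
(* A point beyond the supremum at which the bound still holds. *)
pose w := Num.min v (c + d / 2).
have cw : c < w by rewrite lt_min cv' ltrDl divr_gt0.
have wv : w <= v by rewrite ge_min lexx.
suff : S w by move=> /(ub_le_sup hS.2); rewrite -/c leNgt cw.
have /andP[_ cM] := Sc.
rewrite /S /= wv (le_trans uc (ltW cw)) /=.
rewrite -[f w](subrK (f c)) -[_ + _ - f u]addrA (le_trans (ler_normD _ _))//.
have wc0 : 0 <= w - c by rewrite subr_ge0 ltW.
have -> : M' * (w - u) = M' * `|w - c| + M' * (c - u).
  by rewrite -mulrDr ger0_norm// addrA subrK.
rewrite lerD//; apply: Hd.
  by rewrite (le_trans au (le_trans uc (ltW cw)))/= (le_trans wv).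
rewrite ger0_norm// ltrBlDl (@le_lt_trans _ _ (c + d / 2))//.
  by rewrite ge_min lexx orbT.
by rewrite ltrD2l ltr_pdivrMr// ltr_pMr// ltr1n.
Qed.

Lemma deriv_on_bounded a b f g : a <= b -> deriv_on a b f g ->
  exists2 M, 0 <= M & forall t, a <= t <= b -> `|f t| <= M.
Proof.
move=> ab fg.
have cf : {within `[a, b], continuous (fun t => `|f t|)}.
  apply/subspace_continuousP => t /= tab.
  have {}tab : a <= t <= b by move: tab; rewrite in_itv.
  apply: cvg_norm; apply/cvgrPdist_le => e e0.
  have [d d0 H] := fg t tab 1 ltr01.
  pose K := 1 + `|g t|.
  have K0 : 0 < K by rewrite ltr_wpDr.
  rewrite /prop_near1/= /within /=; apply/nbhs_ballP.
  exists (Num.min d (e / K)) => /=; first by rewrite lt_min d0 divr_gt0.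
  move=> u; rewrite -ball_normE /= lt_min => /andP[tud tue].
  rewrite in_itv /= => uab.
  have := H u uab; rewrite distrC tud => /(_ isT) fut.
  rewrite -normrN opprB -[f u - f t](subrK ((u - t) *: g t)).
  rewrite (le_trans (ler_normD _ _))//.
  apply: (@le_trans _ _ (K * `|t - u|)); last first.
    by rewrite mulrC -ler_pdivlMr// ltW.
  by rewrite /K mulrDl distrC lerD// 1?distrC// normrZ distrC mulrC.
have [c cab H] := EVT_max ab cf.
exists `|f c| => // t tab; apply: H; by rewrite in_itv.
Qed.

End mean_value.

Section smooth_paths.
Context {R : realType} {E : completeNormedModType R}.

(** The second bound is the Lipschitz continuity of the translation in
    1-variation, and comes from the boundedness of the second derivative. *)
Lemma smooth_on_control (a b : R) (y : R -> E) : a <= b -> smooth_on a b y ->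
  exists2 M, 0 <= M & controlled a b (fun t => M * t) y /\
    forall s t c d, a <= s + c -> a <= t + c -> s + d <= b -> t + d <= b ->
      controlled c d (fun w => M * `|s - t| * w)
        (fun w => y (s + w) - y (t + w)).
Proof.
move=> ab [D [D0 DS]].
have dD n : deriv_on a b (D n) (D n.+1) by apply: cvg_deriv_on => t; exact: DS.
have [M1 M10 B1] := deriv_on_bounded ab (dD 1%N).
have [M2 M20 B2] := deriv_on_bounded ab (dD 2%N).
have C0 := mean_value_control (dD 0%N) B1.
have C1 := mean_value_control (dD 1%N) B2.
exists (M1 + M2); first exact: addr_ge0.
split=> [u v au uv vb|s t c d asc atc sdb tdb u v cu uv vd].
  have D0' w : u <= w -> w <= v -> y w = D 0%N w.
    move=> uw wv; rewrite D0// in_itv /= (le_trans au uw)/=.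
    exact: le_trans vb.
  rewrite !D0' ?lexx// (le_trans (C0 u v au uv vb))// -!mulrBr ler_wpM2r//.
    by rewrite subr_ge0.
  by rewrite lerDl.
have inab r w : a <= r + c -> r + d <= b -> c <= w -> w <= d -> a <= r + w <= b.
  move=> arc rdb cw wd; rewrite (le_trans arc) ?lerD2l//=.
  by rewrite (le_trans _ rdb)// lerD2l.
have lip1 r r' : a <= r <= b -> a <= r' <= b ->
    `|D 1%N r - D 1%N r'| <= M2 * `|r - r'|.
  move=> /andP[ar rb] /andP[ar' rb']; have [rr'|r'r] := leP r r'.
    rewrite distrC (distrC r) (ger0_norm (_ : 0 <= r' - r)) ?subr_ge0//.
    by rewrite mulrBr; exact: C1.
  have r0 : 0 <= r - r' by rewrite subr_ge0 ltW.
  rewrite (ger0_norm r0).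
  by rewrite mulrBr; apply: C1 => //; exact: ltW.
(* The mean value inequality for the difference of two translates, whose
   derivative is small because [D 1] is Lipschitz. *)
pose z w := D 0%N (s + w) - D 0%N (t + w).
have dz : deriv_on c d z (fun w => D 1%N (s + w) - D 1%N (t + w)).
  move=> w /andP[cw wd] e e0.
  have e20 : 0 < e / 2 by rewrite divr_gt0.
  have [d1 d10 H1] := dD 0%N _ (inab s w asc sdb cw wd) _ e20.
  have [d2 d20 H2] := dD 0%N _ (inab t w atc tdb cw wd) _ e20.
  exists (Num.min d1 d2); first by rewrite lt_min d10.
  move=> r /andP[cr rd]; rewrite lt_min => /andP[r1 r2].
  have sE (q : R) : q + r - (q + w) = r - w by rewrite [q + r]addrC addrKA.
  have := H1 _ (inab s r asc sdb cr rd); rewrite sE => /(_ r1) {}H1.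
  have := H2 _ (inab t r atc tdb cr rd); rewrite sE => /(_ r2) {}H2.
  have -> : z r - z w - (r - w) *: (D 1%N (s + w) - D 1%N (t + w)) =
      (D 0%N (s + r) - D 0%N (s + w) - (r - w) *: D 1%N (s + w)) -
      (D 0%N (t + r) - D 0%N (t + w) - (r - w) *: D 1%N (t + w)).
    rewrite /z scalerBr [X in X - _]subrACA; exact: subrACA.
  rewrite (le_trans (ler_normB _ _))//.
  by rewrite [e]splitr mulrDl lerD.
have bz w : c <= w <= d ->
    `|D 1%N (s + w) - D 1%N (t + w)| <= (M1 + M2) * `|s - t|.
  move=> /andP[cw wd].
  have sw := inab _ _ asc sdb cw wd; have tw := inab _ _ atc tdb cw wd.
  rewrite (le_trans (lip1 _ _ sw tw))//.
  rewrite [t + w]addrC addrKA ler_wpM2r// lerDr//.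
have zE w : c <= w -> w <= d -> y (s + w) - y (t + w) = z w.
  by move=> cw wd; rewrite /z !D0// in_itv /= inab.
rewrite !zE//; try by [exact: le_trans cu uv|exact: le_trans uv vd].
exact: mean_value_control dz bz _ _ cu uv vd.
Qed.

End smooth_paths.

(** * Iterated integrals *)

Section iterated_integrals.
Context {R : realType} {E : completeNormedModType R} (T : tensorNorms E).

Lemma norm_onep : `|onep T| = 1.
Proof. by rewrite /onep norm_inj norm_ten0. Qed.

Lemma norm_vecp v : `|vecp T v| = `|v|.
Proof. by rewrite /vecp norm_inj norm_ten1. Qed.

Lemma vecpB v w : vecp T (v - w) = vecp T v - vecp T w.
Proof.
have [ml _ _] := tenP T 1.
have upd (x : E) : upd_tuple [tuple 0] ord0 x = [tuple x].
  by apply: eq_from_tnth => j; rewrite tnth_mktuple [j]ord1.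
have := ml ord0 [tuple 0] (-1) w v.
rewrite !upd !scaleN1r addrC [RHS]addrC /vecp => ->.
by rewrite linearB.
Qed.

Lemma RSint_bound k (y : R -> tp T k) (x : R -> E) (s t : R) F M v : s <= t ->
  0 <= M -> (forall u, s <= u -> u <= t -> `|y u| <= M) ->
  controlled s t F x -> is_RSint y x s t v -> `|v| <= M * (F t - F s).
Proof.
move=> st M0 yM Fx yxv; apply/ler_addgt0Pr => e e0.
have [d d0 {}yxv] := yxv _ e0.
have [q pq qd] := fine_partition d0 st.
have nge i : (i < size q)%N -> s <= nth t (s :: q) i.
  by move=> iq; apply: itv_partition_nth_ge => //; rewrite ltnW.
have nle i : (i < size q)%N -> nth t (s :: q) i.+1 <= t.
  by move=> iq; apply: itv_partition_nth_le.
set u := fun i => nth t (s :: q) i.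
have /ltW := yxv q u pq (fun i iq => And3 (lexx _) (qd i iq).1 (qd i iq).2).
set S := \sum_(_ < _) _ => vS.
rewrite -[v](subrK S) addrC (le_trans (ler_normD _ _))// lerD//.
apply: (@le_trans _ _ (psum (fun u v => M * `|x v - x u|) s q)); last first.
  rewrite -(psum_telescope M F pq); apply: (psum_le pq) => w z sw wz zt.
  by rewrite ler_wpM2l// Fx.
rewrite -(psumE _ s t) (le_trans (ler_norm_sum _ _ _))// ler_sum// => i _.
rewrite -(tprodE (addn1 k)) (le_trans (norm_tprod _ _ _))// norm_vecp.
rewrite ler_wpM2r// yM ?nge//.
by rewrite (le_trans _ (nle i _))//; case: (qd i (ltn_ord i)).
Qed.

(** Each integration costs one control increment; an integral that does not
    exist is 0 by convention.  That the two controls may differ is what makes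
    the higher levels negligible on small intervals. *)
Lemma iterint_bound (a b : R) (x : R -> E) F H k s t :
  controlled a b F x -> controlled a b H x -> a <= s -> s <= t -> t <= b ->
  `|iterint T x s k.+1 t| <= (F t - F s) * (H t - H s) ^+ k.
Proof.
move=> Fx Hx sa; elim: k t => [|k IH] t st tb.
  rewrite expr0 mulr1 /=; case: xgetP => [v _ /= vP|_]; last first.
    by rewrite normr0 subr_ge0 (controlled_nd Fx).
  rewrite -[leRHS]mul1r; apply: RSint_bound vP => //; last first.
    exact: controlled_sub Fx _ _.
  by move=> u _ _; rewrite norm_onep.
have F0 : 0 <= F t - F s by rewrite subr_ge0 (controlled_nd Fx).
have H0 : 0 <= H t - H s by rewrite subr_ge0 (controlled_nd Hx).
change (`|xget 0 [set v | is_RSint (iterint T x s k.+1) x s t v]| <=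
  (F t - F s) * (H t - H s) ^+ k.+1).
case: xgetP => [v _ /= vP|_]; last by rewrite normr0 mulr_ge0// exprn_ge0.
rewrite exprSr mulrA; apply: RSint_bound vP => //.
- by rewrite mulr_ge0// exprn_ge0.
- move=> u su ut; rewrite (le_trans (IH u su (le_trans ut tb)))//.
  have F0u : 0 <= F u - F s.
    by rewrite subr_ge0 (controlled_nd Fx)// (le_trans ut).
  have H0u : 0 <= H u - H s.
    by rewrite subr_ge0 (controlled_nd Hx)// (le_trans ut).
  rewrite ler_pM ?exprn_ge0//.
    by rewrite lerB// (controlled_nd Fx)// (le_trans sa).
  rewrite lerXn2r ?nnegrE//.
  by rewrite lerB// (controlled_nd Hx)// (le_trans sa).
- exact: controlled_sub Hx _ _.
Qed.

(** The sums telescope, so the integral exists and is their common value. *)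
Lemma iterint1 (x : R -> E) s t : s <= t ->
  iterint T x s 1 t = vecp T (x t - x s).
Proof.
move=> st.
have sumE q : itv_partition s t q ->
    \sum_(i < size q) castp (addn1 0) (Defs.mul (onep T)
       (vecp T (x (nth t (s :: q) i.+1) - x (nth t (s :: q) i)))) =
    vecp T (x t - x s).
  move=> pq.
  transitivity (\sum_(0 <= i < size q) (vecp T (x (nth t (s :: q) i.+1)) -
      vecp T (x (nth t (s :: q) i)))).
    rewrite big_mkord; apply: eq_bigr => i _.
    by rewrite -(tprodE (addn1 0)) -vecpB; exact: tprod1x.
  rewrite telescope_sumr// vecpB; congr (vecp T (x _) - _).
  exact: itv_partition_nth_size.
apply: xget_unique => /=.
  move=> e e0; exists 1 => // q u pq _.
  by rewrite sumE// subrr normr0.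
move=> v vP; apply/eqP; rewrite -subr_eq0 -normr_le0.
apply/ler_addgt0Pr => e e0.
have [d d0 {}vP] := vP _ e0; have [q pq qd] := fine_partition d0 st.
have := vP q (fun i => nth t (s :: q) i) pq
  (fun i iq => And3 (lexx _) (qd i iq).1 (qd i iq).2).
by rewrite sumE// add0r => /ltW.
Qed.

Lemma RSint_shift k (y : R -> tp T k) (x : R -> E) (c : E) r s t v :
  is_RSint y x (r + s) (r + t) v ->
  is_RSint (fun u => y (r + u)) (fun u => x (r + u) - c) s t v.
Proof.
move=> vP e e0; have [d d0 {}vP] := vP _ e0; exists d => // q u pq qd.
have nE i : nth (r + t) (r + s :: map (+%R r) q) i = r + nth t (s :: q) i.
  rewrite -[r + s :: _]/(map (+%R r) (s :: q)).
  by elim: (s :: q) i => [|z l IH] [|i] /=.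
have := vP _ (fun i => r + u i) (itv_partition_map r pq); rewrite size_map.
move=> {}vP; have -> : \sum_(i < size q) castp (addn1 k)
     (Defs.mul (y (r + u i)) (vecp T (x (r + nth t (s :: q) i.+1) - c -
        (x (r + nth t (s :: q) i) - c)))) =
   \sum_(i < size q) castp (addn1 k) (Defs.mul (y (r + u i))
     (vecp T (x (nth (r + t) (r + s :: map (+%R r) q) i.+1) -
        x (nth (r + t) (r + s :: map (+%R r) q) i)))).
  by apply: eq_bigr => i _; rewrite !nE opprB addrA subrK.
apply: vP => i iq; have [q1 q2 q3] := qd i iq; rewrite !nE !lerD2l; split=> //.
by rewrite opprD addrACA subrr add0r.
Qed.

(** Integrals that do not exist are shifted too, since the sets of their
    candidate values coincide. *)
Lemma iterint_shift (x : R -> E) (c : E) r s k t :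
  iterint T (fun u => x (r + u) - c) s k t = iterint T x (r + s) k (r + t).
Proof.
elim: k t => [//|k IH] t /=; congr xget; apply/seteqP; split => v /= vP.
  have := @RSint_shift k _ _ (- c) (- r) (r + s) (r + t) v.
  rewrite !addKr => /(_ _ _ vP).
  under eq_fun do rewrite IH addNKr.
  by under [X in is_RSint _ X]eq_fun do rewrite addNKr opprK subrK.
have := RSint_shift c vP.
by under eq_fun do rewrite -IH.
Qed.

End iterated_integrals.

(** * Multiplicativity and the higher levels *)

Section multiplicative.
Context {R : realType} {E : completeNormedModType R} (T : tensorNorms E)
  (N : nat).
Let G := truncGroup T N.
Implicit Types (X Y : R -> G) (B : R -> R).

Lemma increment_mul X r s t :
  increment X r t = (increment X r s * increment X s t)%g.
Proof. by rewrite /increment mulgA mulgK. Qed.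

Lemma increment_id X s : increment X s s = 1%g.
Proof. by rewrite /increment mulVg. Qed.

Lemma level_mul (g h : G) k : (k.+1 <= N)%N ->
  (g * h)%g k.+1 = g k.+1 + h k.+1 +
    \sum_(i < k) tprod k.+1 (g (k - i)%N) (h i.+1).
Proof.
move=> kN; change (mull N g h k.+1 = g k.+1 + h k.+1 +
    \sum_(i < k) tprod k.+1 (g (k - i)%N) (h i.+1)).
rewrite /mull kN big_ord_recl big_ord_recr /= subn0 !subnn !lev0 tprodx1.
by rewrite tprod1x -addrA; congr (_ + _); rewrite addrC.
Qed.

Lemma norm_tprodB k i j (x x' : tp T i) (y y' : tp T j) :
  `|tprod k x y - tprod k x' y'| <= `|x - x'| * `|y| + `|x'| * `|y - y'|.
Proof.
have -> : tprod k x y - tprod k x' y' =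
    tprod k (x - x') y + tprod k x' (y - y').
  by rewrite linearBl linearBr addrA subrK.
by rewrite (le_trans (ler_normD _ _))// lerD ?norm_tprod.
Qed.

(** What is kept of a lift: together with multiplicativity, the second property
    determines the higher levels by the first one. *)
Definition lift_controlled (a b : R) B X : Prop :=
  (forall u v k, a <= u -> u <= v -> v <= b -> (1 <= k <= N)%N ->
     `|increment X u v k| <= (B v - B u) ^+ k) /\
  (forall k e, (2 <= k <= N)%N -> 0 < e -> exists2 d, 0 < d &
     forall u v, a <= u -> u <= v -> v <= b -> v - u < d ->
     `|increment X u v k| <= e * (B v - B u)).

(** For [k >= 2] the sums of the level [k] over fine partitions are
    negligible, so by the product formula the level [k] is determined by the
    lower ones, with an explicit bound. *)
Lemma lift_controlled_dist (a b : R) B X Y l :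
  lift_controlled a b B X -> lift_controlled a b B Y -> 0 <= l ->
  (forall u v, a <= u -> u <= v -> v <= b ->
     `|increment X u v 1%N - increment Y u v 1%N| <= l * (B v - B u)) ->
  forall k u v, a <= u -> u <= v -> v <= b -> (1 <= k <= N)%N ->
    `|increment X u v k - increment Y u v k|
      <= (2 * N%:R) ^+ k * (l * (B v - B u) ^+ k).
Proof.
move=> [bX sX] [bY sY] l0 XY1 k; have [n] := ubnP k.
elim: n k => // n IH [//|[_|k kn]] u v au uv vb /andP[_ kN].
  rewrite !expr1 (le_trans (XY1 _ _ au uv vb))//.
  rewrite -[leLHS]mul1r ler_wpM2r//.
    by rewrite (le_trans _ (XY1 _ _ au uv vb)).
  by rewrite -natrM ler1n muln_gt0.
have N0 : (0 < N)%N by exact: leq_trans kN.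
have Bnd r s : a <= r -> r <= s -> s <= b -> 0 <= B s - B r.
  move=> ar rs sb; have := bX r s 1%N ar rs sb.
  by rewrite N0 expr1 => /(_ isT); exact: le_trans.
pose D r s m := `|increment X r s m - increment Y r s m|.
pose c : R := (2 * N%:R) ^+ k.+1.
have c0 : 0 <= c by rewrite exprn_ge0// mulr_ge0.
pose bt := B v - B u.
have bt0 : 0 <= bt by exact: Bnd.
(* The mixed products at level [k.+2], when the interval is cut once, cost at
   most [K] per unit of control of the second part. *)
pose K := k.+1%:R * (2 * (c * l * bt ^+ k.+1)).
have K0 : 0 <= K by rewrite !mulr_ge0// exprn_ge0.
have lower m r s : a <= r -> r <= s -> s <= b -> (0 < m <= k.+1)%N ->
    D r s m <= c * l * (B s - B r) ^+ m.
  move=> ar rs sb /andP[m0 mk]; have mN : (0 < m <= N)%N.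
    by rewrite m0 (leq_trans mk)// ltnW.
  rewrite (le_trans (IH _ _ _ _ ar rs sb mN))//.
    by rewrite (leq_ltn_trans mk).
  rewrite mulrA ler_wpM2r ?exprn_ge0 ?Bnd// ler_wpM2r//.
  by rewrite /c ler_weXn2l// -natrM ler1n muln_gt0.
have stepD r s : u <= r -> r <= s -> s <= v ->
    D u s k.+2 <= D u r k.+2 + D r s k.+2 + K * (B s - B r).
  move=> ur rs sv; rewrite /D !(increment_mul _ u r s) !level_mul//.
  set p1 := increment X u r; set p2 := increment X r s.
  set q1 := increment Y u r; set q2 := increment Y r s.
  rewrite opprD addrACA (le_trans (ler_normD _ _))//.
  rewrite opprD addrACA lerD ?ler_normD// -sumrB.
  rewrite (le_trans (ler_norm_sum _ _ _))//.
  have -> : K * (B s - B r) =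
      \sum_(i < k.+1) 2 * (c * l * bt ^+ k.+1) * (B s - B r).
    by rewrite sumr_const card_ord /K -mulrA mulr_natl.
  apply: ler_sum => i _.
  have ar : a <= r by exact: le_trans ur.
  have sb : s <= b by exact: le_trans vb.
  have us := le_trans ur rs; have rb := le_trans rs sb.
  have ik : (0 < k.+1 - i <= k.+1)%N by rewrite subn_gt0 ltn_ord leq_subr.
  have ik' : (0 < i.+1 <= k.+1)%N by rewrite ltn_ord.
  have widen m : (0 < m <= k.+1)%N -> (0 < m <= N)%N.
    by move=> /andP[-> mk]; rewrite (leq_trans mk)// ltnW.
  rewrite (le_trans (norm_tprodB _ _ _ _ _))//.
  have rv : r <= v by exact: le_trans sv.
  have Pbt : B r - B u <= bt by rewrite lerD2r -subr_ge0 Bnd.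
  have Qbt : B s - B r <= bt.
    by rewrite lerB// -subr_ge0 Bnd// (le_trans au us).
  have P0 : 0 <= B r - B u by rewrite Bnd.
  have Q0 : 0 <= B s - B r by rewrite Bnd.
  set P := B r - B u in Pbt P0 *; set Q := B s - B r in Qbt Q0 *.
  apply: (@le_trans _ _ (2 * (c * l * (P ^+ (k.+1 - i) * Q ^+ i.+1)))).
    rewrite [2]mulr2n mulrDl mul1r lerD//.
      rewrite mulrA ler_pM//; first by exact: lower.
      by apply: bX => //; exact: widen.
    rewrite mulrCA ler_pM//; first by apply: bY => //; exact: widen.
    exact: lower.
  rewrite -[X in _ <= X]mulrA ler_wpM2l// -[X in _ <= X]mulrA.
  rewrite ler_wpM2l ?mulr_ge0//.
  rewrite exprSr mulrA ler_wpM2r//.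
  rewrite -[in leRHS](subnK (ltnW (ltn_ord i))) exprD.
  by rewrite ler_pM ?exprn_ge0// lerXn2r ?nnegrE.
(* Cutting one interval of the partition after the other, the costs add up to
   at most [K] times the total control. *)
have chain r q : u <= r -> itv_partition r v q ->
    D u v k.+2 <= D u r k.+2 + psum (fun r s => D r s k.+2) r q +
                  K * (B v - B r).
  elim: q r => [|s q IHq] r ur.
    by move=> /itv_partition_nil ->; rewrite subrr mulr0 !addr0.
  move=> /itv_partition_consE[rs pq] /=.
  have sv := itv_partition_le pq.
  rewrite (le_trans (IHq s (le_trans ur (ltW rs)) pq))//.
  have := stepD r s ur (ltW rs) sv.
  move: (D u r _) (D u s _) (D r s _) (psum _ _ _) => x y z w.
  lra.
apply/ler_addgt0Pr => e e0.
(* Both paths contribute [e' * bt]; the summand 1 covers [bt = 0]. *)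
pose e' := e / (2 * bt + 1).
have bt1 : 0 < 2 * bt + 1 by rewrite ltr_wpDl// mulr_ge0.
have e'0 : 0 < e' by rewrite divr_gt0.
have [d1 d10 H1] := sX k.+2 e' kN e'0.
have [d2 d20 H2] := sY k.+2 e' kN e'0.
have [|q pq qd] := @fine_partition _ (Num.min d1 d2) u v _ uv.
  by rewrite lt_min d10.
have := chain u q (lexx u) pq.
have -> : D u u k.+2 = 0 by rewrite /D !increment_id subrr normr0.
rewrite add0r => /le_trans -> //.
rewrite addrC lerD//.
  rewrite /K -/bt [_ ^+ k.+2]exprS -/c [bt ^+ k.+2]exprSr.
  have -> : k.+1%:R * (2 * (c * l * bt ^+ k.+1)) * bt =
    k.+1%:R * (2 * c * (l * (bt ^+ k.+1 * bt))) by ring.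
  have -> : 2 * N%:R * c * (l * (bt ^+ k.+1 * bt)) =
    N%:R * (2 * c * (l * (bt ^+ k.+1 * bt))) by ring.
  by rewrite ler_wpM2r ?mulr_ge0 ?exprn_ge0// ler_nat ltnW.
apply: (@le_trans _ _ (psum (fun r s => (2 * e') * (B s - B r)) u q)).
  rewrite -!(psumE _ u v); apply: ler_sum => i _.
  have [i1] := qd i (ltn_ord i); rewrite lt_min => /andP[i3 i4].
  have a1 : a <= nth v (u :: q) i.
    by rewrite (le_trans au)// (itv_partition_nth_ge _ pq)// ltnW// ltnS.
  have b1 : nth v (u :: q) i.+1 <= b.
    by rewrite (le_trans _ vb)// (itv_partition_nth_le _ pq)// ltnS.
  rewrite (le_trans (ler_normB _ _))// [2]mulr2n mulrDl mul1r mulrDl lerD//.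
    exact: H1.
  exact: H2.
rewrite (psum_telescope _ _ pq) -/bt.
have -> : 2 * e' * bt = e * (2 * bt) / (2 * bt + 1) by rewrite /e'; ring.
by rewrite ler_pdivrMr// ler_wpM2l ?(ltW e0)// lerDl.
Qed.

End multiplicative.

(** * Lifts and their translates *)

Section bounded_variation.
Context {R : realType} {E : completeNormedModType R}.

Lemma C01var_split (a b : R) (x : R -> E) e : a <= b -> C01var a b x -> 0 < e ->
  exists y : R -> E, exists2 A : R -> R,
    smooth_on a b y & controlled a b A (fun t => x t - y t) /\ A b - A a < e.
Proof.
move=> ab [_ /[apply]] [y [sy _ /(one_var_control ab)[A Axy Ae]]].
by exists y, A.
Qed.

(** The remainder contributes at most [e], however short the interval, and the
    smooth path contributes its Lipschitz constant. *)
Lemma C01var_control (a b : R) (x : R -> E) e :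
  a <= b -> C01var a b x -> 0 < e ->
  exists F : R -> R, exists2 M, 0 <= M & controlled a b F x /\
    forall u v, a <= u -> u <= v -> v <= b -> F v - F u <= e + M * (v - u).
Proof.
move=> ab xC e0; have [y [A sy [Axy Ae]]] := C01var_split ab xC e0.
have [M M0 [My _]] := smooth_on_control ab sy.
exists (fun t => A t + M * t), M => //; split.
  have := controlledD Axy My.
  by under [X in controlled _ _ _ X]eq_fun do rewrite subrK.
move=> u v au uv vb; rewrite opprD addrACA -mulrBr lerD2r.
rewrite (le_trans _ (ltW Ae))// lerB//.
  by apply: (controlled_nd Axy) => //; exact: le_trans uv.
by apply: (controlled_nd Axy) => //; exact: le_trans vb.
Qed.

End bounded_variation.

Section lifts.
Context {R : realType} {E : completeNormedModType R} (T : tensorNorms E)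
  (N : nat).
Let G := truncGroup T N.
Implicit Types (X Y : R -> G) (B F : R -> R).

(** For the second property one of the [k] control increments remains that of
    [F] and the others are those of a control [H] that is small on short
    intervals, which [F] need not be. *)
Lemma lift_lift_controlled (a b : R) (x : R -> E) X F : a <= b ->
  C01var a b x -> is_lift a b x X -> controlled a b F x ->
  lift_controlled a b F X.
Proof.
move=> ab xC [_ xX] Fx; split=> [u v k au uv vb kN|k e /andP[k2 kN] e0].
  rewrite xX//; case: k kN => // k _.
  by rewrite exprS; exact: (iterint_bound _ _ Fx Fx au uv vb).
(* On short intervals [H] varies by at most [2 * h], which is at most 1, so
   that powers are harmless, and at most [e]. *)
pose h := Num.min 1 e / 2.
have h0 : 0 < h by rewrite divr_gt0// lt_min ltr01.
have [H [M M0 [Hx HM]]] := C01var_control ab xC h0.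
have M1 : 0 < M + 1 by rewrite ltr_wpDl.
exists (h / (M + 1)) => [|u v au uv vb uvd]; first by rewrite divr_gt0.
have k1 : (1 <= k <= N)%N by rewrite kN (ltn_trans _ k2).
rewrite xX//; case: k k2 {kN k1} => [//|[//|k]] _.
rewrite (le_trans (iterint_bound _ _ Fx Hx au uv vb))// mulrC.
have F0 : 0 <= F v - F u by rewrite subr_ge0 (controlled_nd Fx).
have H0 : 0 <= H v - H u by rewrite subr_ge0 (controlled_nd Hx).
rewrite ler_wpM2r//.
have Hh : H v - H u <= Num.min 1 e.
  rewrite (le_trans (HM _ _ au uv vb))// [leRHS]splitr lerD2l -/h.
  rewrite ltr_pdivlMr// in uvd; rewrite (le_trans _ (ltW uvd))// mulrC.
  by rewrite ler_wpM2l ?subr_ge0// lerDl.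
move: Hh; rewrite le_min => /andP[H1 He].
by rewrite exprS (le_trans _ He)// ler_piMr// exprn_ile1.
Qed.

Lemma lift_controlledD (a b : R) B C X :
  (1 <= N)%N -> lift_controlled a b B X ->
  (forall u v, a <= u -> u <= v -> v <= b -> C u <= C v) ->
  lift_controlled a b (fun t => B t + C t) X.
Proof.
move=> N1 [bX sX] ndC.
have B0 u v : a <= u -> u <= v -> v <= b -> 0 <= B v - B u.
  move=> au uv vb; have := bX u v 1%N au uv vb.
  by rewrite N1 expr1 => /(_ isT); exact: le_trans.
have BC u v : a <= u -> u <= v -> v <= b ->
    B v - B u <= B v + C v - (B u + C u).
  by move=> au uv vb; rewrite opprD addrACA lerDl subr_ge0 ndC.
split=> [u v k au uv vb kN|k e kN e0].
  rewrite (le_trans (bX _ _ _ au uv vb kN))//.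
  by rewrite lerXn2r ?nnegrE ?B0 ?BC// (le_trans (B0 _ _ au uv vb)) ?BC.
have [d d0 H] := sX _ _ kN e0; exists d => // u v au uv vb uvd.
by rewrite (le_trans (H _ _ au uv vb uvd))// ler_pM2l// BC.
Qed.

Definition translate (t : R) X : R -> G := fun h => increment X t (t + h).

Lemma increment_translate t X u v :
  increment (translate t X) u v = increment X (t + u) (t + v).
Proof.
rewrite /translate /increment; apply: (@mulgI _ ((X t)^-1 * X (t + u))%g).
by rewrite mulVKg mulgA mulgK.
Qed.

Lemma lift_controlled_translate (a b a' b' t : R) B X :
  lift_controlled a' b' B X -> a' <= t + a -> t + b <= b' ->
  lift_controlled a b (fun u => B (t + u)) (translate t X).
Proof.
move=> [bX sX] a'a bb'.
have L u : a <= u -> a' <= t + u by move=> au; rewrite (le_trans a'a)// lerD2l.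
have Rt v : v <= b -> t + v <= b'.
  by move=> vb; rewrite (le_trans _ bb')// lerD2l.
split=> [u v k au uv vb kN|k e kN e0].
  by rewrite increment_translate bX ?L ?Rt ?lerD2l.
have [d d0 H] := sX _ _ kN e0; exists d => // u v au uv vb uvd.
rewrite increment_translate H ?L ?Rt ?lerD2l//.
by rewrite opprD addrACA subrr add0r.
Qed.

Lemma is_lift_translate (a b a' b' t : R) (x : R -> E) X : is_lift a' b' x X ->
  a' <= t + a -> t + b <= b' ->
  is_lift a b (fun u => x (t + u) - x t) (translate t X).
Proof.
move=> [_ xX] a'a bb'; split.
  by rewrite /translate addr0 increment_id.
move=> s u k sa su ub kN; rewrite increment_translate iterint_shift xX//.
- by rewrite (le_trans a'a)// lerD2l.
- by rewrite lerD2l.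
- by rewrite (le_trans _ bb')// lerD2l.
Qed.

(** Smallness of [dpvar p a b X Y] without suprema and roots; [dpvar_pvar_le]
    and [pvar_le_dpvar] relate the two. *)
Definition pvar_le (p a b : R) X Y e : Prop :=
  forall k q, (1 <= k <= N)%N -> itv_partition a b q ->
    psum (fun u v => `|increment X u v k - increment Y u v k| `^ (p / k%:R)) a q
      <= e.

(** With [m := min 1 e / K], the level [k] of the difference is at most the
    power [k] of [m * (B v - B u)].  Its power [p / k] is then the power [p] of
    a number in [[0, 1]], which is at most that number, and these bounds
    telescope to [m * K <= e]. *)
Lemma pvar_le_lift (p a b : R) X Y B K e : 1 <= p -> (1 <= N)%N -> 0 < e ->
  1 <= K -> B b - B a <= K ->
  lift_controlled a b B X -> lift_controlled a b B Y ->
  (forall u v, a <= u -> u <= v -> v <= b ->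
     `|increment X u v 1%N - increment Y u v 1%N|
       <= (Num.min 1 e / K) ^+ N / (2 * N%:R) ^+ N * (B v - B u)) ->
  pvar_le p a b X Y e.
Proof.
move=> p1 N1 e0 K1 BK bX bY XY1 k q kN pq.
have K0 : 0 < K by exact: lt_le_trans K1.
have /andP[k0 kN'] := kN.
have kR0 : k%:R != 0 :> R by rewrite pnatr_eq0 -lt0n.
set m := Num.min 1 e / K in XY1.
have m0 : 0 < m by rewrite divr_gt0// lt_min ltr01.
have mK : m * K <= 1 by rewrite divfK ?gt_eqF// ge_min lexx.
have me : m * K <= e by rewrite divfK ?gt_eqF// ge_min lexx orbT.
have m1 : m <= 1 by rewrite (le_trans _ mK)// ler_peMr// ltW.
have N2 : 1 <= 2 * N%:R :> R by rewrite -natrM ler1n muln_gt0.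
have l0 : 0 <= m ^+ N / (2 * N%:R) ^+ N.
  by rewrite divr_ge0// exprn_ge0// ltW.
have D := lift_controlled_dist bX bY l0 XY1.
have B0 u v : a <= u -> u <= v -> v <= b -> 0 <= B v - B u.
  move=> au uv vb; have := bX.1 u v 1%N au uv vb.
  by rewrite N1 expr1 => /(_ isT); exact: le_trans.
apply: (@le_trans _ _ (psum (fun u v => m * (B v - B u)) a q)); last first.
  by rewrite (psum_telescope _ _ pq) (le_trans _ me)// ler_pM2l.
apply: (psum_le pq) => u v au uv vb.
have Buv := B0 _ _ au uv vb.
have BuvK : B v - B u <= K.
  rewrite (le_trans _ BK)// lerB// -subr_ge0 B0//; first exact: le_trans uv.
  exact: le_trans vb.
have Dk : `|increment X u v k - increment Y u v k| <= (m * (B v - B u)) ^+ k.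
  rewrite (le_trans (D _ _ _ au uv vb kN))// [leRHS]exprMn [leLHS]mulrA.
  rewrite ler_wpM2r ?exprn_ge0//.
  rewrite [leLHS]mulrA ler_pdivrMr ?exprn_gt0 ?(lt_le_trans _ N2)//.
  rewrite [leLHS]mulrC ler_pM ?exprn_ge0 ?(ltW m0) ?(le_trans _ N2)//.
    by rewrite ler_wiXn2l// ltW.
  by rewrite ler_weXn2l.
have mB0 : 0 <= m * (B v - B u) by rewrite mulr_ge0// ltW.
apply: (@le_trans _ _ (((m * (B v - B u)) ^+ k) `^ (p / k%:R))).
  rewrite ge0_ler_powR ?nnegrE// ?exprn_ge0//.
  by rewrite divr_ge0// (le_trans _ p1).
rewrite -powR_mulrn// -powRrM [k%:R * _]mulrC divfK//.
have [->|mBn0] := eqVneq (m * (B v - B u)) 0.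
  by rewrite powR0// gt_eqF// (lt_le_trans _ p1).
apply: ge1r_powR => //; rewrite lt_neqAle eq_sym mBn0 mB0 /=.
by rewrite (le_trans _ mK)// ler_pM2l.
Qed.

(** The translation is continuous on the lifts: [x] splits into a smooth path,
    whose translates differ by a Lipschitz function with a small constant,
    and a path of small variation.  The control [B] of the levels contains
    the control [C] of the difference blown up by the factor [l^-1], which
    makes the first levels [l]-close relatively to [B]. *)
Lemma translate_lift_cvg (p a' b' : R) (x : R -> E) X e :
  1 <= p -> (1 <= N)%N ->
  a' <= b' -> C01var a' b' x -> is_lift a' b' x X -> 0 < e ->
  exists2 d, 0 < d & forall s t a b, a' <= s + a -> s + b <= b' ->
    a' <= t + a -> t + b <= b' -> `|s - t| < d ->
    pvar_le p a b (translate s X) (translate t X) e.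
Proof.
move=> p1 N1 ab' xC xX e0.
have [F [M' M'0 [Fx _]]] := C01var_control ab' xC ltr01.
have ndF u v : a' <= u -> u <= v -> v <= b' -> F u <= F v.
  exact: controlled_nd Fx.
pose K := (F b' - F a') *+ 2 + 1.
have F0 : 0 <= F b' - F a' by rewrite subr_ge0 ndF.
have K1 : 1 <= K by rewrite lerDr mulrn_wge0.
have K0 : 0 < K by exact: lt_le_trans K1.
pose l := (Num.min 1 e / K) ^+ N / (2 * N%:R) ^+ N.
have l0 : 0 < l.
  have m0 : 0 < Num.min 1 e / K by rewrite divr_gt0// lt_min ltr01.
  by rewrite divr_gt0// exprn_gt0// mulr_gt0// ltr0n.
have l40 : 0 < l / 4 by rewrite divr_gt0.
have [y [A sy [Axy Al]]] := C01var_split ab' xC l40.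
have [M M0 [_ My]] := smooth_on_control ab' sy.
have D0 : 0 < 2 * (M * (b' - a') + 1).
  by rewrite mulr_gt0// ltr_wpDl// mulr_ge0// subr_ge0.
exists (l / (2 * (M * (b' - a') + 1))); first by rewrite divr_gt0.
move=> s t a b a's b's a't b't st k q kN pq.
have ab := itv_partition_le pq.
pose C u := M * `|s - t| * u + (A (s + u) + A (t + u)).
have Cx : controlled a b C (fun u => x (s + u) - x (t + u)).
  have Ast := controlledD (controlled_shift Axy a's b's)
    (controlledN (controlled_shift Axy a't b't)).
  suff -> : (fun u => x (s + u) - x (t + u)) = (fun u => y (s + u) - y (t + u) +
      ((x (s + u) - y (s + u)) - (x (t + u) - y (t + u)))).
    exact: controlledD (My s t a b a's a't b's b't) Ast.
  by apply/funext => u; rewrite subrACA [RHS]addrC subrK.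
pose B u := F (s + u) + F (t + u) + l^-1 * C u.
have inL r u : a' <= r + a -> a <= u -> a' <= r + u.
  by move=> ra au; rewrite (le_trans ra)// lerD2l.
have inR r u : r + b <= b' -> u <= b -> r + u <= b'.
  by move=> rb ub; rewrite (le_trans _ rb)// lerD2l.
have ndC u v : a <= u -> u <= v -> v <= b -> l^-1 * C u <= l^-1 * C v.
  by move=> au uv vb; rewrite ler_pM2l ?invr_gt0// (controlled_nd Cx).
have ndFr r : a' <= r + a -> r + b <= b' ->
    forall u v, a <= u -> u <= v -> v <= b ->
    F (r + u) <= F (r + v).
  move=> ra rb u v au uv vb; apply: ndF; rewrite ?lerD2l//; first exact: inL.
  exact: inR.
have XF := lift_lift_controlled ab' xC xX Fx.
have bX : lift_controlled a b B (translate s X).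
  apply: lift_controlledD => //; apply: lift_controlledD => //.
    exact: lift_controlled_translate XF a's b's.
  exact: ndFr.
have bY : lift_controlled a b B (translate t X).
  apply: lift_controlledD => //.
  under [X in lift_controlled _ _ X]eq_fun do rewrite addrC.
  apply: lift_controlledD => //.
    exact: lift_controlled_translate XF a't b't.
  exact: ndFr.
apply: (pvar_le_lift p1 N1 e0 K1 _ bX bY) => //.
  have Cl : C b - C a <= l.
    have Ar r : a' <= r + a -> r + b <= b' -> A (r + b) - A (r + a) <= l / 4.
      move=> ra rb; rewrite (le_trans _ (ltW Al))//.
      have rab : r + a <= r + b by rewrite lerD2l.
      apply: lerB; apply: (controlled_nd Axy) => //; first exact: le_trans rab.
      exact: le_trans rb.
    have As := Ar s a's b's; have At := Ar t a't b't.
    have ba : b - a <= b' - a' by lra.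
    have Mst : M * `|s - t| * (b - a) <= l / 2.
      apply: (@le_trans _ _ (`|s - t| * (M * (b' - a') + 1))).
        rewrite [M * _]mulrC -mulrA ler_wpM2l//.
        by rewrite ler_wpDr// ler_wpM2l.
      by rewrite ler_pdivlMr// -mulrA [_ * 2]mulrC -ler_pdivlMr// ltW.
    rewrite /C; lra.
  have Fr r : a' <= r + a -> r + b <= b' ->
      F (r + b) - F (r + a) <= F b' - F a'.
    move=> ra rb; have rab : r + a <= r + b by rewrite lerD2l.
    by apply: lerB; apply: ndF => //; [exact: le_trans rab|exact: le_trans rb].
  have Fs := Fr s a's b's; have Ft := Fr t a't b't.
  have : l^-1 * (C b - C a) <= 1 by rewrite mulrC ler_pdivrMr// mul1r.
  rewrite /B /K mulr2n; lra.
move=> u v au uv vb; rewrite -/l !increment_translate.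
have lvl r : a' <= r + a -> r + b <= b' ->
    increment X (r + u) (r + v) 1%N = vecp T (x (r + v) - x (r + u)).
  move=> ra rb; have uvr : r + u <= r + v by rewrite lerD2l.
  by rewrite (xX.2 _ _ _ (inL _ _ ra au) uvr (inR _ _ rb vb))// iterint1.
rewrite !lvl//.
rewrite -vecpB norm_vecp.
rewrite subrACA (le_trans (Cx _ _ au uv vb))//.
apply: (@le_trans _ _ (l * (l^-1 * C v - l^-1 * C u))).
  by rewrite -mulrBr mulrA divff ?gt_eqF// mul1r.
rewrite ler_pM2l// /B opprD addrACA lerDr opprD addrACA.
by rewrite addr_ge0 ?subr_ge0 ?ndFr.
Qed.

End lifts.

(** * The p-variation distance *)

Section pvar_balls.
Context {R : realType} {E : completeNormedModType R} (T : tensorNorms E)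
  (N : nat) (p : R) (p1 : 1 <= p).
Let G := truncGroup T N.
Implicit Types (X Y Z : R -> G).

Let p0 : 0 < p. Proof. exact: lt_le_trans p1. Qed.

Lemma pvar_le_sym (a b : R) X Y e : pvar_le p a b X Y e -> pvar_le p a b Y X e.
Proof.
move=> XY k q kN pq; rewrite (le_trans _ (XY k q kN pq))//.
by apply: (psum_le pq) => u v _ _ _; rewrite distrC.
Qed.

(** A weak triangle inequality, from [(x + y)^q <= 2^q (x^q + y^q)]: the
    exponents [q = p / k] may lie on both sides of 1. *)
Lemma pvar_le_triangle (a b : R) Y X Z e f :
  pvar_le p a b X Y e -> pvar_le p a b Y Z f ->
  pvar_le p a b X Z (2 `^ p * (e + f)).
Proof.
move=> XY YZ k q kN pq; have /andP[k0 _] := kN.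
have r0 : 0 <= p / k%:R by rewrite divr_ge0// ltW.
have rp : p / k%:R <= p.
  by rewrite ler_pdivrMr ?ltr0n// ler_peMr ?ler1n// ltW.
apply: (@le_trans _ _ (2 `^ p * (
  psum (fun u v => `|increment X u v k - increment Y u v k| `^ (p / k%:R)) a q +
  psum (fun u v => `|increment Y u v k - increment Z u v k| `^ (p / k%:R)) a q))).
  rewrite -psumD -psumZ; apply: (psum_le pq) => u v _ _ _.
  set x := increment X u v k; set y := increment Y u v k.
  set z := increment Z u v k.
  have xz : `|x - z| <= 2 * Num.max `|x - y| `|y - z|.
    have -> : x - z = (x - y) + (y - z) by rewrite addrA subrK.
    rewrite (le_trans (ler_normD _ _))// [2]mulr2n mulrDl mul1r.
    by rewrite lerD// le_max lexx ?orbT.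
  apply: (@le_trans _ _ ((2 * Num.max `|x - y| `|y - z|) `^ (p / k%:R))).
    by rewrite ge0_ler_powR ?nnegrE// mulr_ge0// le_max normr_ge0.
  rewrite powRM ?le_max ?normr_ge0//.
  apply: ler_pM; rewrite ?powR_ge0//; first by rewrite ler_powR// ler1n.
  by rewrite /Num.max; case: ifP => _; rewrite ?lerDl ?lerDr powR_ge0.
by rewrite ler_wpM2l ?powR_ge0// lerD ?XY ?YZ.
Qed.

Lemma pvar_le_translate (a b a' b' t : R) X Y e : pvar_le p a' b' X Y e ->
  a' <= t + a -> t + b <= b' ->
  pvar_le p a b (translate t X) (translate t Y) e.
Proof.
move=> XY a'a bb' k q kN pq.
have [|q' pq' le_q'] := @psum_extend _
  (fun u v => `|increment X u v k - increment Y u v k| `^ (p / k%:R))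
  t a b a' b' q _ pq a'a bb'; first by move=> *; exact: powR_ge0.
rewrite (le_trans _ (XY k q' kN pq'))// (le_trans _ le_q')//.
by apply: (psum_le pq) => u v _ _ _; rewrite !increment_translate.
Qed.

Lemma eq_pvar_le (a b : R) X X' Y Y' e :
  (forall u, a <= u -> u <= b -> X u = X' u) ->
  (forall u, a <= u -> u <= b -> Y u = Y' u) ->
  pvar_le p a b X Y e -> pvar_le p a b X' Y' e.
Proof.
move=> XX' YY' XY k q kN pq; rewrite (le_trans _ (XY k q kN pq))//.
apply: (psum_le pq) => u v au uv vb; have av := le_trans au uv.
by rewrite /increment !XX' ?YY'// (le_trans uv).
Qed.

Lemma dpvar_psum (a b : R) X Y : dpvar p a b X Y =
  \big[maxe/0%E]_(1 <= k < N.+1)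
    (ereal_sup [set (psum (fun u v =>
       `|increment X u v k - increment Y u v k| `^ (p / k%:R)) a q)%:E
       | q in itv_partition a b] `^ p^-1)%E.
Proof.
apply: eq_bigr => k _; congr (ereal_sup _ `^ _)%E; apply: eq_imagel => q _.
by rewrite -(psumE _ a b).
Qed.

Lemma dpvar_pvar_le (a b : R) X Y e :
  (dpvar p a b X Y < e%:E)%E -> pvar_le p a b X Y (e `^ p).
Proof.
rewrite dpvar_psum => XYe k q kN pq.
set s := psum _ _ _.
have s0 : 0 <= s by rewrite psum_ge0// => *; exact: powR_ge0.
have -> : s = (s `^ p^-1) `^ p by rewrite -powRrM mulVf ?gt_eqF// powRr1.
have /ltW : s `^ p^-1 < e.
  rewrite -lte_fin -poweR_EFin (le_lt_trans _ XYe)//.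
  have kin : k \in index_iota 1 N.+1 by rewrite mem_index_iota.
  apply: (bigmax_sup_seq _ _ _ _ _ kin) => //.
  have sS : (s%:E <= ereal_sup [set (psum (fun u v =>
       `|increment X u v k - increment Y u v k| `^ (p / k%:R)) a q)%:E
       | q in itv_partition a b])%E by apply: ereal_sup_ubound; exists q.
  apply: gt0_ler_poweR => //; rewrite ?invr_ge0 ?ltW//.
    by rewrite in_itv /= lee_fin s0 leey.
  by rewrite in_itv /= leey andbT (le_trans _ sS)// lee_fin.
move=> se; rewrite ge0_ler_powR ?nnegrE ?powR_ge0 ?(ltW p0)//.
by rewrite (le_trans _ se)// powR_ge0.
Qed.

Lemma pvar_le_dpvar (a b : R) X Y e : 0 <= e -> a <= b ->
  pvar_le p a b X Y (e `^ p) -> (dpvar p a b X Y <= e%:E)%E.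
Proof.
rewrite dpvar_psum => e0 ab XYe; rewrite big_seq.
apply: (big_ind (fun z => (z <= e%:E)%E)); first by rewrite lee_fin.
  by move=> x y xe ye; rewrite ge_max xe.
move=> k; rewrite mem_index_iota ltnS => kN.
have -> : e%:E = ((e `^ p)%:E `^ p^-1)%E.
  by rewrite poweR_EFin -powRrM divff ?gt_eqF// powRr1.
set S := ereal_sup _.
have Se : (S <= (e `^ p)%:E)%E.
  by apply: ge_ereal_sup => _ [q pq <-]; rewrite lee_fin; exact: XYe.
have S0 : (0 <= S)%E.
  have [q pq _] := fine_partition ltr01 ab.
  apply: (le_trans _ (ereal_sup_ubound (ex_intro2 _ _ q pq erefl))).
  by rewrite lee_fin psum_ge0// => *; exact: powR_ge0.
apply: gt0_ler_poweR => //; rewrite ?invr_ge0 ?ltW//.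
  by rewrite in_itv /= S0 leey.
by rewrite in_itv /= leey andbT lee_fin powR_ge0.
Qed.

End pvar_balls.

(** * The Wiener shift *)

Section translations.
Context {R : realType} {E : completeNormedModType R} (T : tensorNorms E)
  (N : nat).
Let G := truncGroup T N.

Lemma C01var_translate (a b a' b' t : R) (x : R -> E) : C01var a' b' x ->
  a' <= t + a -> t + b <= b' -> C01var a b (fun u => x (t + u) - x t).
Proof.
move=> [_ xC] a'a bb'; split=> [|e e0]; first by rewrite addr0 subrr.
have [z [[D [D0 DS]] _ xz]] := xC _ e0.
have inI u : u \in `[a, b] -> t + u \in `[a', b'].
  rewrite !in_itv /= => /andP[au ub].
  by rewrite (le_trans a'a) ?lerD2l//= (le_trans _ bb') ?lerD2l.
exists (fun u => z (t + u) - z t); split.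
- exists (fun n u => if n is 0 then D n (t + u) - z t else D n (t + u)).
  split=> [u uab|n u uab]; first by rewrite D0 ?inI.
  have -> : (fun h => h^-1 *: ((if n is 0 then D n (t + (u + h)) - z t
      else D n (t + (u + h))) - (if n is 0 then D n (t + u) - z t
      else D n (t + u)))) =
      (fun h => h^-1 *: (D n (t + u + h) - D n (t + u))).
    apply/funext => h; rewrite addrA; case: n => // .
    by rewrite opprB addrA subrK.
  apply: cvg_trans (DS n (t + u) (inI _ uab)); apply: cvg_fmap2.
  apply: within_subset => h /=; rewrite -addrA; exact: inI.
- by rewrite addr0 subrr.
- apply: le_lt_trans xz.
  have -> : (fun u => x (t + u) - x t - (z (t + u) - z t)) =
      (fun u => (fun w => x w - z w) (t + u) - (x t - z t)).
    by apply/funext => u; rewrite subrACA.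
  exact: one_var_shift.
Qed.

Lemma mulg_continuous (c : G) : continuous (fun g : G => (c * g)%g).
Proof.
move=> g; apply: (iffRL (@cvg_ballP R G G (nbhs g) (nbhs_filter g) _ _)) => e e0.
pose M := \sum_(j < N.+1) `|c j|.
have cM j : (j <= N)%N -> `|c j| <= M.
  move=> jN; rewrite /M (bigD1 (Ordinal (jN : (j < N.+1)%N)))//= lerDl.
  exact: sumr_ge0.
pose K := N.+1%:R * M + 1.
have M0 : 0 <= M by exact: sumr_ge0.
have K0 : 0 < K by rewrite ltr_wpDl// mulr_ge0.
apply/nbhs_ballP; exists (e / K) => /=; first exact: divr_gt0.
move=> h; rewrite !ballEmdist /= => gh.
rewrite ltr_pdivlMr// in gh; apply: le_lt_trans gh.
have d0 : 0 <= mdist g h by exact: mdist_ge0.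
have dlev j : (j <= N)%N -> `|g j - h j| <= mdist g h.
  move=> jN; exact: (le_bigmax _ (fun k : 'I_N.+1 => `|g k - h k|)
    (Ordinal (jN : (j < N.+1)%N))).
apply/bigmax_leP; split=> [|[k /= kN] _]; first by rewrite mulr_ge0// ltW.
rewrite ltnS in kN.
change (`|mull N c g k - mull N c h k| <= mdist g h * K).
rewrite /mull kN -sumrB (le_trans (ler_norm_sum _ _ _))//.
apply: (@le_trans _ _ (\sum_(i < k.+1) M * mdist g h)).
  apply: ler_sum => i _; rewrite -linearBr (le_trans (norm_tprod _ _ _))//.
  have iN : (i <= N)%N by rewrite (leq_trans _ kN)// -ltnS.
  by rewrite ler_pM ?cM ?dlev// (leq_trans (leq_subr _ _)).
rewrite sumr_const card_ord -mulr_natl mulrA [leRHS]mulrC ler_wpM2r//.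
rewrite /K ler_wpDr// ler_wpM2r// ler_nat ltnS//.
Qed.

Lemma translate_continuous (t : R) (X : R -> G) :
  continuous X -> continuous (translate t X).
Proof.
move=> cX u.
have c1 : (t + h) @[h --> u] --> t + u.
  by apply: cvgD; [exact: cvg_cst|exact: cvg_id].
have c2 : X (t + h) @[h --> u] --> X (t + u) by exact: cvg_comp c1 (cX _).
exact: cvg_comp c2 (@mulg_continuous _ _).
Qed.

Section approximation.
Context (p : R) (p1 : 1 <= p).

Let p0 : 0 < p. Proof. exact: lt_le_trans p1. Qed.

Lemma C0pvarP (a b : R) (X : R -> G) : a <= b -> C0pvar p a b X <->
  [/\ {within `[a, b], continuous X}, X 0 = 1%g & forall e, 0 < e ->
    exists (x : R -> E) (Y : R -> G),
      [/\ C01var a b x, is_lift a b x Y & pvar_le p a b X Y e]].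
Proof.
move=> ab; split=> [[cX X0 [x [Y [xY dXY]]]]|[cX X0 H]]; split=> //.
  move=> e e0.
  have e10 : 0 < e `^ p^-1 by exact: powR_gt0.
  have [n _ /(_ n (leqnn _)) Hn] :
      \forall n \near \oo, (dpvar p a b X (Y n) < (e `^ p^-1)%:E)%E.
    apply: (dXY [set z | (z < (e `^ p^-1)%:E)%E]).
    apply: open_nbhs_nbhs; split; first exact: open_ereal_lt_ereal.
    by rewrite /= lte_fin.
  exists (x n), (Y n); have [xn Yn] := xY n; split=> //.
  by have := dpvar_pvar_le p1 Hn; rewrite -powRrM mulVf ?gt_eqF// powRr1// ltW.
have /choice[xY HxY] : forall n, exists xY : (R -> E) * (R -> G),
    [/\ C01var a b xY.1, is_lift a b xY.1 xY.2 &
        pvar_le p a b X xY.2 (n.+1%:R^-1 `^ p)].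
  move=> n; have [|x [Y ?]] := H (n.+1%:R^-1 `^ p); first by rewrite powR_gt0.
  by exists (x, Y).
exists (fun n => (xY n).1), (fun n => (xY n).2); split.
  by move=> n; have [] := HxY n.
apply: (@squeeze_cvge _ _ _ _ (cst 0%E) _ (fun n => (n.+1%:R^-1)%:E)).
- apply: nearW => n; have [_ _ HY] := HxY n.
  by rewrite bigmax_ge_id /= pvar_le_dpvar.
- exact: cvg_cst.
- apply: cvg_EFin; first by apply: nearW.
  exact: cvg_harmonic.
Qed.

Lemma C0pvar_translate (a b a' b' t : R) (X : R -> G) : a <= b ->
  C0pvar p a' b' X -> a' <= t + a -> t + b <= b' ->
  {within `[a, b], continuous (translate t X)} ->
  C0pvar p a b (translate t X).
Proof.
move=> ab XC a'a bb' cX.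
have ab' : a' <= b' by rewrite (le_trans a'a)// (le_trans _ bb')// lerD2l.
move: XC => /(C0pvarP _ ab')[_ _ H]; apply/C0pvarP => //; split=> //.
  by rewrite /translate addr0 increment_id.
move=> e /H[x [Y [xC xY XY]]].
exists (fun u => x (t + u) - x t), (translate t Y); split.
- exact: C01var_translate xC a'a bb'.
- exact: is_lift_translate xY a'a bb'.
- exact: pvar_le_translate XY a'a bb'.
Qed.

Lemma eq_C0pvar (a b : R) (X Y : R -> G) : a <= 0 -> 0 <= b ->
  (forall u, a <= u -> u <= b -> X u = Y u) ->
  C0pvar p a b X -> C0pvar p a b Y.
Proof.
move=> a0 b0 XY; have ab := le_trans a0 b0.
move=> /(C0pvarP _ ab)[cX X0 H]; apply/C0pvarP => //; split.
- apply: (subspace_eq_continuous _ cX) => u; rewrite inE /= in_itv /=.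
  by move=> /andP[]; exact: XY.
- by rewrite -XY.
- move=> e /H[x [Z [xC xZ XZ]]]; exists x, Z; split=> //.
  exact: eq_pvar_le XZ.
Qed.

Lemma restrict_pathE (J : interval0 R) (X : R -> G) u :
  lo J <= u -> u <= hi J -> restrict_path J X u = X u.
Proof.
move=> Ju uJ; rewrite /restrict_path /patch mem_setE in_itv /= Ju uJ //.
Qed.

Implicit Types (w : roughPath T N p1) (J : interval0 R).

Lemma lo_le_hi J : lo J <= hi J.
Proof. exact: le_trans (lo_le0 J) (hi_ge0 J). Qed.

Lemma roughPath_C0pvar w J : C0pvar p (lo J) (hi J) w.
Proof.
apply: eq_C0pvar (rpathP w J); [exact: lo_le0|exact: hi_ge0|].
exact: restrict_pathE.
Qed.

Lemma roughPath0 w : w 0 = 1%g.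
Proof. by have [] := roughPath_C0pvar w (Interval0 (lexx 0) (lexx 0)). Qed.

Lemma roughPath_inj w w' : rpath w = rpath w' -> w = w'.
Proof.
case: w w' => [w cw Pw] [w' cw' Pw'] /= ww'; case: w' / ww' in cw' Pw' *.
by congr RoughPath; exact: Prop_irrelevance.
Qed.

Lemma enlarge_lo J t : Num.min 0 (t + lo J - 1) <= 0.
Proof. by rewrite ge_min lexx. Qed.

Lemma enlarge_hi J t : 0 <= Num.max 0 (t + hi J + 1).
Proof. by rewrite le_max lexx. Qed.

(** The unit of slack on both sides makes room for varying [t]. *)
Definition enlarge J t := Interval0 (enlarge_lo J t) (enlarge_hi J t).

Lemma enlargeP J s t : `|s - t| < 1 ->
  lo (enlarge J t) <= s + lo J /\ s + hi J <= hi (enlarge J t).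
Proof.
rewrite ltr_norml => /andP[s1 s2] /=; split.
  by rewrite ge_min; apply/orP; right; lra.
by rewrite le_max; apply/orP; right; lra.
Qed.

Lemma translate_C0pvar t w J :
  C0pvar p (lo J) (hi J) (restrict_path J (translate t w)).
Proof.
apply: (@eq_C0pvar _ _ (translate t w)).
- exact: lo_le0.
- exact: hi_ge0.
- by move=> u Ju uJ; rewrite restrict_pathE.
have [l h] : lo (enlarge J t) <= t + lo J /\ t + hi J <= hi (enlarge J t).
  by apply: enlargeP; rewrite subrr normr0.
apply: (C0pvar_translate (lo_le_hi J) (roughPath_C0pvar w (enlarge J t)) l h).
apply: continuous_subspaceT; apply: translate_continuous.
exact: rpath_continuous.
Qed.

Definition wiener_shift (t : R) w : roughPath T N p1 :=
  RoughPath p1 (translate_continuous (@rpath_continuous _ _ _ _ _ _ w))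
    (translate_C0pvar t w).

Lemma wiener_shift0 : wiener_shift 0 = id.
Proof.
apply/funext => w; apply: roughPath_inj; apply/funext => h /=.
by rewrite /translate /increment roughPath0 invg1 mul1g add0r.
Qed.

Lemma wiener_shiftD s t :
  wiener_shift (s + t) = wiener_shift s \o wiener_shift t.
Proof.
apply/funext => w; apply: roughPath_inj; apply/funext => h /=.
rewrite [RHS]/translate increment_translate /translate.
by rewrite [t + s]addrC addrCA addrA.
Qed.

Lemma wiener_shift_cocycle w s t : w (s + t) = (w s * wiener_shift s w t)%g.
Proof. by rewrite /= /translate /increment mulVKg. Qed.

End approximation.

End translations.

(** * Joint continuity and measurability *)

Section topology.
Context {R : realType} {E : completeNormedModType R} (T : tensorNorms E)
  (N : nat) (p : R) (p1 : 1 <= p) (N1 : (1 <= N)%N).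
Let G := truncGroup T N.
Implicit Types (w : roughPath T N p1) (J : interval0 R).

Let p0 : 0 < p. Proof. exact: lt_le_trans p1. Qed.
Let C : R := 2 `^ p.
Let C0 : 0 < C. Proof. exact: powR_gt0. Qed.
Let C1 : 1 <= C. Proof. by rewrite -(powRr0 2) ler_powR ?ler1n// ltW. Qed.

Lemma path_openP J (U : set (pathOn T N p J)) :
  open U <-> forall x, U x -> exists2 e, 0 < e &
    forall y : pathOn T N p J, pvar_le p (lo J) (hi J) x y e -> U y.
Proof.
change (path_open U <-> forall x, U x -> exists2 e, 0 < e &
    forall y : pathOn T N p J, pvar_le p (lo J) (hi J) x y e -> U y).
split=> H x /H[e e0 He].
  exists ((e / 2) `^ p) => [|y xy]; first by rewrite powR_gt0// divr_gt0.
  apply: He; apply: (@le_lt_trans _ _ (e / 2)%:E).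
    by apply: pvar_le_dpvar => //; [rewrite divr_ge0// ltW|exact: lo_le_hi].
  by rewrite lte_fin ltr_pdivrMr// ltr_pMr// ltr1n.
exists (e `^ p^-1) => [|y xy]; first exact: powR_gt0.
apply: He; have := dpvar_pvar_le p1 xy.
by rewrite -powRrM mulVf ?gt_eqF// powRr1// ltW.
Qed.

Lemma pvar_lexx (a b : R) (X : R -> G) e : 0 <= e -> pvar_le p a b X X e.
Proof.
move=> e0 k q /andP[k0 _] _.
elim: q a => //= c q IH a; rewrite subrr normr0 powR0 ?add0r//.
by rewrite gt_eqF// divr_gt0// ltr0n.
Qed.

Lemma pvar_le_w (a b : R) (X Y : R -> G) e f : e <= f ->
  pvar_le p a b X Y e -> pvar_le p a b X Y f.
Proof. by move=> ef XY k q kN pq; rewrite (le_trans (XY k q kN pq)). Qed.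

(** [U] is the interior of the ball; by the weak triangle inequality it
    contains, with a ball inside the given one, a concentric ball smaller by
    the factor [2 `^ p * 2]. *)
Lemma pvar_ball_nbhs J (x : pathOn T N p J) e : 0 < e ->
  exists U : set (pathOn T N p J), [/\ open U, U x &
    forall y : pathOn T N p J, U y -> pvar_le p (lo J) (hi J) x y e].
Proof.
move=> e0; exists [set y | exists2 d, 0 < d & forall z : pathOn T N p J,
  pvar_le p (lo J) (hi J) y z d -> pvar_le p (lo J) (hi J) x z e]; split.
- apply/path_openP => y [d d0 Hd].
  have h0 : 0 < d / (C * 2) by rewrite divr_gt0// mulr_gt0.
  exists (d / (C * 2)) => // z yz; exists (d / (C * 2)) => // v zv.
  apply: Hd; apply: pvar_le_w (pvar_le_triangle p1 yz zv).
  have Cn0 : C != 0 by rewrite gt_eqF.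
  suff -> : 2 `^ p * (d / (C * 2) + d / (C * 2)) = d by [].
  by rewrite -/C; field.
- by exists e.
- by move=> y [d d0]; apply; apply: pvar_lexx; exact: ltW.
Qed.

Lemma roughPath_ball_nbhs w J e : 0 < e ->
  exists V : set (roughPath T N p1), [/\ open V, V w &
    forall w' : roughPath T N p1, V w' -> pvar_le p (lo J) (hi J) w w' e].
Proof.
move=> e0; have [U [oU Uw HU]] := pvar_ball_nbhs (restriction J w) e0.
exists (restriction J @^-1` U); split=> //.
  exists [set (restriction J @^-1` U)]; last first.
    by apply/seteqP; split=> [v [_ ->]|v ?]//; exists (restriction J @^-1` U).
  by move=> _ ->; apply: (finI_from1 id); exists J, U.
by move=> w' /HU; apply: eq_pvar_le => u; exact: restrict_pathE.
Qed.

Lemma roughPath_approx w J e : 0 < e -> exists (x : R -> E) (Y : R -> G),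
  [/\ C01var (lo J) (hi J) x, is_lift (lo J) (hi J) x Y &
      pvar_le p (lo J) (hi J) w Y e].
Proof.
move=> e0; have /(C0pvarP p1 _ (lo_le_hi J))[_ _] := roughPath_C0pvar w J.
exact.
Qed.

(** Joint continuity at one restriction: the two paths are compared through
    the translates of a lift close to [w]. *)
Lemma wiener_shift_near w t J e : 0 < e ->
  exists V : set (roughPath T N p1), [/\ open V, V w & exists2 d, 0 < d &
    forall w' s, V w' -> `|s - t| < d ->
      pvar_le p (lo J) (hi J) (wiener_shift t w) (wiener_shift s w') e].
Proof.
move=> e0; set J' := enlarge J t.
(* Four comparisons through three weak triangle inequalities. *)
pose h := e / (C ^+ 3 * 4).
have h0 : 0 < h by rewrite divr_gt0// mulr_gt0// exprn_gt0.
have [x [Y [xC xY wY]]] := roughPath_approx w J' h0.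
have [d d0 Hd] := translate_lift_cvg p1 N1 (lo_le_hi J') xC xY h0.
have [V [oV Vw HV]] := roughPath_ball_nbhs w J' h0.
exists V; split=> //; exists (Num.min 1 d); first by rewrite lt_min ltr01.
move=> w' s Vw'; rewrite lt_min => /andP[st1 std].
have [ls hs] := enlargeP J st1.
have [lt ht] : lo J' <= t + lo J /\ t + hi J <= hi J'.
  by apply: enlargeP; rewrite subrr normr0.
have s1 := pvar_le_translate wY lt ht.
have s2 : pvar_le p (lo J) (hi J) (translate t Y) (translate s Y) h.
  by apply: Hd => //; rewrite distrC.
have s3 := pvar_le_sym (pvar_le_translate wY ls hs).
have s4 := pvar_le_translate (HV _ Vw') ls hs.
have s34 := pvar_le_triangle p1 s3 s4.
have := pvar_le_triangle p1 s1 (pvar_le_triangle p1 s2 s34).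
rewrite -/C; apply: pvar_le_w.
have CC : C <= C ^+ 3 by rewrite -{1}[C]expr1 ler_weXn2l.
have CC2 : C ^+ 2 <= C ^+ 3 by rewrite ler_weXn2l.
have -> : C * (h + C * (h + C * (h + h))) = h * (C + C ^+ 2 + C ^+ 3 *+ 2).
  by ring.
have he : h * (C ^+ 3 * 4) = e by rewrite divfK// gt_eqF// mulr_gt0// exprn_gt0.
by rewrite -[leRHS]he ler_pM2l// mulr2n; lra.
Qed.

(** An open set contains, around each of its points, a finite intersection of
    preimages under restrictions, and [wiener_shift_near] handles each of
    them. *)
Lemma wiener_shift_open (A : set (roughPath T N p1)) w t :
  open A -> A (wiener_shift t w) ->
  exists V : set (roughPath T N p1), [/\ open V, V w & exists2 d, 0 < d &
    forall w' s, V w' -> `|s - t| < d -> A (wiener_shift s w')].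
Proof.
move=> [B sB <-] [D BD Dwt]; have /sB[F sF FD] := BD.
suff [V [oV Vw [d d0 H]]] : exists V : set (roughPath T N p1),
    [/\ open V, V w & exists2 d, 0 < d & forall w' s, V w' -> `|s - t| < d ->
      forall S, S \in finmap.enum_fset F -> S (wiener_shift s w')].
  exists V; split=> //; exists d => // w' s Vw' st; exists D => //.
  change (D (wiener_shift s w')); rewrite -FD => S /= SF.
  exact: (H _ _ Vw' st).
have {}sF S : S \in finmap.enum_fset F -> exists J (U : set (pathOn T N p J)),
    open U /\ S = restriction J @^-1` U.
  by move=> /sF; rewrite in_setE.
have {}Dwt S : S \in finmap.enum_fset F -> S (wiener_shift t w).
  move=> SF; have : D (wiener_shift t w) by exact: Dwt.
  by rewrite -FD; apply.
have {sF Dwt} {B sB D BD FD} H S : S \in finmap.enum_fset F ->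
    exists V : set (roughPath T N p1), [/\ open V, V w & exists2 d, 0 < d &
    forall w' s, V w' -> `|s - t| < d -> S (wiener_shift s w')].
  move=> SF; have [J [U [/path_openP oU SU]]] := sF _ SF.
  have := Dwt _ SF; rewrite SU => /= /oU[e e0 He].
  have [V [oV Vw [d d0 Hd]]] := wiener_shift_near w t J e0.
  exists V; split=> //; exists d => // w' s Vw' st; apply: He.
  apply: eq_pvar_le (Hd w' s Vw' st) => u Ju uJ; by rewrite /= restrict_pathE.
suff aux (l : seq (set (roughPath T N p1))) :
    (forall S, S \in l -> S \in finmap.enum_fset F) ->
    exists V : set (roughPath T N p1),
    [/\ open V, V w & exists2 d, 0 < d & forall w' s, V w' -> `|s - t| < d ->
      forall S, S \in l -> S (wiener_shift s w')].
  by apply: (aux (finmap.enum_fset F)).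
elim: l => [_|S l IH sl].
  by exists setT; split=> //; [exact: openT|exists 1].
have [|V [oV Vw [d d0 Hd]]] := IH.
  by move=> S' S'l; rewrite sl// inE S'l orbT.
have [|V' [oV' V'w [d' d'0 Hd']]] := H S; first by rewrite sl// mem_head.
exists (V `&` V'); split=> //; first exact: openI.
exists (Num.min d d'); first by rewrite lt_min d0.
move=> w' s [Vw' V'w']; rewrite lt_min => /andP[sd sd'] S'.
by rewrite inE => /predU1P[->|S'l]; [exact: Hd'|exact: Hd].
Qed.

End topology.

Section measurability.
Context {R : realType} {E : completeNormedModType R} (T : tensorNorms E)
  (N : nat) (p : R) (p1 : 1 <= p) (N1 : (1 <= N)%N).

(** The path space may be nonseparable, but the line is second countable, so
    an open subset of the product is a countable union of open boxes. *)
Lemma measurable_wiener_shift :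
  measurable_fun [set: borelRoughPath T N p1 * R]
    (fun z => wiener_shift z.2 z.1 : borelRoughPath T N p1).
Proof.
apply: (@measurability _ _ (borelRoughPath T N p1 * R)%type
  (borelRoughPath T N p1) _ _ (@open (roughPath T N p1))) => // _ [A oA <-].
rewrite setTI.
pose I (q : rat * rat) : set R := `]ratr q.1, ratr q.2[%classic.
pose U (q : rat * rat) : set (roughPath T N p1) :=
  \bigcup_(V in [set V : set (roughPath T N p1) | open V /\
     forall w t, V w -> I q t -> A (wiener_shift t w)]) V.
suff -> : (fun z : borelRoughPath T N p1 * R =>
    wiener_shift z.2 z.1 : borelRoughPath T N p1) @^-1` A =
    \bigcup_q ((U q : set (borelRoughPath T N p1)) `*` I q).
  apply: countable_bigcupT_measurable; first exact: countableP.
  move=> q; apply: measurableX; last exact: measurable_itv.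
  by apply: sub_sigma_algebra; apply: bigcup_open => V [].
apply/seteqP; split=> [[w t]/= Awt|[w t] /=]; last first.
  by move=> [q _ [/= [V [oV VA] Vw] tq]]; exact: VA.
have [V [oV Vw [d d0 H]]] := wiener_shift_open N1 oA Awt.
have [q1 q1t] : exists q, (ratr q : R) \in `]t - d, t[.
  by apply: rat_in_itvoo; rewrite ltrBlDr ltrDl.
have [q2 q2t] : exists q, (ratr q : R) \in `]t, t + d[.
  by apply: rat_in_itvoo; rewrite ltrDl.
move: q1t q2t; rewrite !in_itv /= => /andP[q1l q1r] /andP[q2l q2r].
exists (q1, q2) => //; split; last by rewrite /I /= in_itv /= q1r q2l.
exists V => //; split=> // w' s Vw'; rewrite /I /= in_itv /= => /andP[s1 s2].
apply: H => //; rewrite ltr_norml; lra.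
Qed.

End measurability.

(** * The canonical dynamical system *)

Theorem theorem5 (R : realType) (E : completeNormedModType R)
    (T : tensorNorms E) (p : R) (p1 : 1 <= p) (N : nat) (N1 : (1 <= N)%N)
    (dbar : measure_display) (Omegabar : measurableType dbar)
    (Pbar : probability Omegabar R)
    (Xbar : {RV Pbar >-> borelRoughPath T N p1})
    (Xbar_stationary : stationary_increments Xbar) :
  exists (d : measure_display) (Omega : measurableType d)
    (P : probability Omega R) (theta : R -> Omega -> Omega)
    (X : {RV P >-> borelRoughPath T N p1}),
    [/\ metric_dynamical_system P theta,
        forall B : set (borelRoughPath T N p1), measurable B ->
          distribution P X B = distribution Pbar Xbar B
      & cocycle theta X].
Proof.
pose P : probability (borelRoughPath T N p1) R := distribution Pbar Xbar.
pose mX := isMeasurableFun.Build _ _ _ _ (@idfun (borelRoughPath T N p1))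
  (@measurable_id _ (borelRoughPath T N p1) setT).
pose X : {RV P >-> borelRoughPath T N p1} :=
  HB.pack (@idfun (borelRoughPath T N p1)) mX.
exists _, (borelRoughPath T N p1), P, (@wiener_shift _ _ _ _ _ p1), X; split.
- split.
  + exact: measurable_wiener_shift.
  + exact: wiener_shift0.
  + exact: wiener_shiftD.
  + move=> t A mA.
    have lawE s : increment_law Xbar s A =
        Pbar (Xbar @^-1` (wiener_shift s @^-1` A)).
      congr (Pbar _); apply/seteqP; split=> [v [y Ay yE]|v Av] /=.
        rewrite (_ : wiener_shift s (Xbar v) = y)//.
        by apply: roughPath_inj; rewrite yE.
      by exists (wiener_shift s (Xbar v)).
    by have := Xbar_stationary t 0 A mA; rewrite !lawE wiener_shift0.
- by [].
- by move=> w s t; exact: wiener_shift_cocycle.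
Qed.
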